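(* Let $\Delta$ be any lattice in $\operatorname{PSL}_2(\mathbb{C})$ with $\Gamma_{\mathcal{W}}\leq\Delta\leq\Gamma_{\mathcal{O}}$. If $\Delta=\Gamma_{\mathcal{O}}$, or if $\Delta$ is conjugate in $\Gamma_{\mathcal{O}}$ to the orbifold fundamental group $\pi_1^{\mathrm{orb}}(\Theta_3(2,2,2))=\langle\Gamma_{\mathcal{W}},R,S\rangle$, then $H_2(\Delta,\mathbb{Z})\cong\mathbb{Z}/2\mathbb{Z}$. Otherwise $H_2(\Delta,\mathbb{Z})=0$.
   Context: The Weeks manifold $\mathcal{W}$ is the unique closed orientable hyperbolic $3$-manifold of minimal volume; $\mathcal{W}=\mathbb{H}^3/\Gamma_{\mathcal{W}}$ with $$\Gamma_{\mathcal{W}}=\pi_1(\mathcal{W})=\langle a,b \mid a^2b^2a^2=ba^{-1}b,\ b^2a^2b^2=ab^{-1}a\rangle .$$ It is arithmetic. Let $k$ be the cubic field of discriminant $-23$, $B_{\mathcal{W}}$ the quaternion algebra over $k$ ramified at the real place and at the prime of norm $5$, $\mathcal{O}$ a maximal order in $B_{\mathcal{W}}$, $\Gamma_{\mathcal{O}}^1<\operatorname{PSL}_2(\mathbb{C})$ the image of the group of (norm-one) units of $\mathcal{O}$, and $\Gamma_{\mathcal{O}}$ the normalizer of $\Gamma_{\mathcal{O}}^1$ in $\operatorname{PSL}_2(\mathbb{C})$. Background facts: $\Gamma_{\mathcal{W}}$ is normal of index $12$ in $\Gamma_{\mathcal{O}}$ and $\Gamma_{\mathcal{O}}/\Gamma_{\mathcal{W}}=\operatorname{Isom}(\mathcal{W})\cong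 D_6$ (dihedral of order $12$). The group $\Gamma_{\mathcal{O}}$ is generated by $\Gamma_{\mathcal{W}}$ and elements $R,S,T$ with $RaR^{-1}=a^{-1}$, $RbR^{-1}=b^{-1}$, $SaS^{-1}=b$, $SbS^{-1}=a$, $TaT^{-1}=a$, $TbT^{-1}=a^{-1}b^{-1}$ and $R^2=S^2=(RS)^2=(RT)^2=(ST)^3=1$, $T^2=a^{-1}$. The orbifold $\Theta_3(2,2,2)$ (notation of Mednykh and Vesnin) is the quotient of $\mathcal{W}$ by the subgroup $C_2\times C_2$ of $\operatorname{Isom}(\mathcal{W})$ generated by the images of $R$ and $S$. The intermediate lattices correspond to subgroups of $D_6$, and are considered up to conjugacy (there are ten conjugacy classes). *)

(* Defs.v *)
From HB Require Import structures.
From mathcomp Require Import all_boot all_order all_algebra all_fingroup.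
From mathcomp Require Import all_solvable all_field.
From mathcomp Require Import generic_quotient ring_quotient ring.
From mathcomp Require Import mathcomp_extra boolp classical_sets functions.
From mathcomp Require Import reals ereal topology normedtype measure.
From mathcomp Require Import lebesgue_measure lebesgue_integral.
From mathcomp.real_closed Require Import complex.
From mathcomp.multinomials Require Import freeg.

Set Implicit Arguments.
Unset Strict Implicit.
Unset Printing Implicit Defensive.

Import Order.TTheory GRing.Theory Num.Theory.
Import numFieldNormedType.Exports.

Local Open Scope classical_set_scope.
Local Open Scope quotient_scope.
Local Open Scope ring_scope.

Record subgroup (G : groupType) := Subgroup {
  sg_set :> set G;
  sg_one : sg_set 1%g;
  sg_mul : forall x y, sg_set x -> sg_set y -> sg_set (x * y)%g;
  sg_inv : forall x, sg_set x -> sg_set (x^-1)%g }.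

Section SubgroupType.
Variables (G : groupType) (H : subgroup G).

Definition sg_pred : {pred G} := [pred x | `[< sg_set H x >]].

Lemma sg_pred_closed : group_closed sg_pred.
Proof.
split; first by apply/asboolP; exact: sg_one.
move=> x y /asboolP Hx /asboolP Hy; apply/asboolP.
by apply: sg_mul => //; apply: sg_inv.
Qed.

Definition sg_type := {x : G | sg_pred x}.

HB.instance Definition _ := SubType.copy sg_type {x : G | sg_pred x}.
HB.instance Definition _ := Choice.copy sg_type {x : G | sg_pred x}.
HB.instance Definition _ :=
  @SubChoice_isSubGroup.Build G sg_pred sg_type sg_pred_closed.

End SubgroupType.

Section GroupConstructions.
Variable G : groupType.
Implicit Types (A X : set G) (H : subgroup G) (g x y : G).

Definition gen_set A : set G :=
  [set x | forall H, A `<=` H -> sg_set H x].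

Lemma gen_one A : gen_set A 1%g.
Proof. by move=> H _; exact: sg_one. Qed.

Lemma gen_mul A x y : gen_set A x -> gen_set A y -> gen_set A (x * y)%g.
Proof. by move=> gx gy H AH; apply: sg_mul; [exact: gx | exact: gy]. Qed.

Lemma gen_inv A x : gen_set A x -> gen_set A (x^-1)%g.
Proof. by move=> gx H AH; apply: sg_inv; exact: gx. Qed.

Definition gen A : subgroup G :=
  Subgroup (@gen_one A) (@gen_mul A) (@gen_inv A).

(* [g * x * g^-1] is written out because [x ^ g] is [g^-1 * x * g]. *)
Definition conj_set g X : set G := [set (g * x * g^-1)%g | x in X].

Definition normalizer_set X : set G := [set g | conj_set g X = X].

Lemma conj_set1 X : conj_set 1%g X = X.
Proof.
apply/seteqP; split=> [_ [x Xx <-]|x Xx]; first by rewrite invg1 mulg1 mul1g.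
by exists x; rewrite // invg1 mulg1 mul1g.
Qed.

Lemma conj_setM g h X : conj_set (g * h)%g X = conj_set g (conj_set h X).
Proof.
apply/seteqP; split=> [_ [x Xx <-]|_ [_ [x Xx <-] <-]].
  by exists (h * x * h^-1)%g; [exists x | rewrite invgM !mulgA].
by exists x; rewrite // invgM !mulgA.
Qed.

Lemma normalizer_one X : normalizer_set X 1%g.
Proof. exact: conj_set1. Qed.

Lemma normalizer_mul X g h :
  normalizer_set X g -> normalizer_set X h -> normalizer_set X (g * h)%g.
Proof. by rewrite /normalizer_set /= => ng nh; rewrite conj_setM nh. Qed.

Lemma normalizer_inv X g : normalizer_set X g -> normalizer_set X (g^-1)%g.
Proof.
by rewrite /normalizer_set /= => ng; rewrite -{1}ng -conj_setM mulVg conj_set1.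
Qed.

Definition normalizer X : subgroup G :=
  Subgroup (@normalizer_one X) (@normalizer_mul X) (@normalizer_inv X).

End GroupConstructions.

(* [N] is normal in [H] and [H / N] is isomorphic to [Q]: there is a
   homomorphism of [H] onto [Q] with kernel [N]. *)
Definition quotient_isomorphic (G Q : groupType) (H N : subgroup G) : Prop :=
  N `<=` H /\
  exists f : {multiplicative sg_type H -> Q},
    (forall q, exists x, f x = q) /\
    (forall x, f x = 1%g <-> sg_set N (val x)).

(* The letter [(i, false)] is the generator [i], [(i, true)] its inverse. *)
Definition word (I : Type) := seq (I * bool).

Section Presentation.
Variables (I : Type) (E : set (word I * word I)).

(* Equality in the group with generators [I] and relations [l = r] for
   [(l, r)] in [E]. *)
Inductive pres_eq : word I -> word I -> Prop :=
| pres_refl u : pres_eq u u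
| pres_sym u v : pres_eq u v -> pres_eq v u
| pres_trans u v w : pres_eq u v -> pres_eq v w -> pres_eq u w
| pres_cancel u v i e : pres_eq (u ++ [:: (i, e); (i, ~~ e)] ++ v) (u ++ v)
| pres_rel u v l r : E (l, r) -> pres_eq (u ++ l ++ v) (u ++ r ++ v).

Variables (G : groupType) (f : I -> G).

Definition word_eval (w : word I) : G :=
  (\prod_(l <- w) (if l.2 then (f l.1)^-1 else f l.1))%g.

Definition is_presentation (H : set G) : Prop :=
  H = gen (range f) :> set G /\
  forall u v, word_eval u = word_eval v <-> pres_eq u v.

End Presentation.

(* a^2 b^2 a^2 = b a^-1 b and b^2 a^2 b^2 = a b^-1 a, with generators
   a = [false] and b = [true]. *)
Definition weeks_relations : set (word bool * word bool) :=
  let a := (false, false) in let a' := (false, true) in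
  let b := (true, false) in let b' := (true, true) in
  [set ([:: a; a; b; b; a; a], [:: b; a'; b]);
       ([:: b; b; a; a; b; b], [:: a; b'; a])].

(* Inhomogeneous bar complex, with trivial coefficients Z. *)

Section BarComplex.
Variable G : groupType.

Definition bar_chain (n : nat) := {freeg (n.-tuple G) / int}.

(* The i-th face of (t_0, ..., t_n) drops t_0 if i = 0, drops t_n if
   i = n + 1, and multiplies t_(i-1) by t_i otherwise. *)
Definition bar_face n (i : 'I_n.+2) (t : n.+1.-tuple G) : n.-tuple G :=
  [tuple let x := tnth t (widen_ord (leqnSn n) j) in
         let y := tnth t (fintype.lift ord0 j) in
         if (j.+1 < i)%N then x else if j.+1 == i then (x * y)%g else y
  | j < n].

Definition bar_diffS n : bar_chain n.+1 -> bar_chain n :=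
  fglift (fun t => \sum_(i < n.+2) << ((-1) ^+ i) *g bar_face i t >>).

Definition bar_diff n : bar_chain n -> bar_chain n.-1 :=
  if n is m.+1 then @bar_diffS m else fun=> 0.

Lemma bar_diff_zmod_morphism n : zmod_morphism (@bar_diff n).
Proof.
case: n => [|n] x y /=; first by rewrite subr0.
exact: lift_is_additive.
Qed.

HB.instance Definition _ n :=
  GRing.isZmodMorphism.Build (bar_chain n) (bar_chain n.-1) (@bar_diff n)
    (@bar_diff_zmod_morphism n).

Definition bar_cycle n : {pred bar_chain n} := [pred x | bar_diff x == 0].

Lemma bar_cycle_closed n : zmod_closed (@bar_cycle n).
Proof.
split=> [|x y]; rewrite !inE; first by rewrite raddf0.
move=> /eqP dx /eqP dy; rewrite raddfB /=.
by rewrite dx dy subr0.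
Qed.

Definition bar_cycles n := {x : bar_chain n | bar_cycle x}.
HB.instance Definition _ n :=
  SubType.copy (bar_cycles n) {x : bar_chain n | bar_cycle x}.
HB.instance Definition _ n :=
  Choice.copy (bar_cycles n) {x : bar_chain n | bar_cycle x}.
HB.instance Definition _ n :=
  @GRing.SubChoice_isSubZmodule.Build
    _ _ (bar_cycles n) (@bar_cycle_closed n).

Definition bar_boundary n : {pred bar_cycles n} :=
  [pred z | `[< exists y : bar_chain n.+1, bar_diff y = val z >]].

Lemma bar_boundary_closed n : zmod_closed (@bar_boundary n).
Proof.
split=> [|x y]; first by apply/asboolP; exists 0; rewrite !raddf0.
move=> /asboolP[u du] /asboolP[v dv]; apply/asboolP; exists (u - v).
rewrite [RHS]raddfB; apply: etrans (congr2 (fun s t => s - t) du dv).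
exact: (raddfB (@bar_diff n.+1)).
Qed.

HB.instance Definition _ n :=
  GRing.isZmodClosed.Build (bar_cycles n) (@bar_boundary n)
    (@bar_boundary_closed n).

Definition group_homology (n : nat) := Quotient.quot (@bar_boundary n).

End BarComplex.

Definition zmod_isog (A B : zmodType) : Prop :=
  exists f : {additive A -> B}, bijective f.

Section PSL2.
Variable F : fieldType.

Definition SL2 := {A : 'M[F]_2 | \det A == 1}.
HB.instance Definition _ := SubType.copy SL2 {A : 'M[F]_2 | \det A == 1}.
HB.instance Definition _ := Choice.copy SL2 {A : 'M[F]_2 | \det A == 1}.

Lemma SL2_det (A : SL2) : \det (val A) = 1.
Proof. exact/eqP/(valP A). Qed.

Lemma SL2_unit (A : SL2) : val A \in unitmx.
Proof. by rewrite unitmxE SL2_det unitr1. Qed.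

Fact SL2_one_subproof : \det (1%:M : 'M[F]_2) == 1.
Proof. by rewrite det1. Qed.

Fact SL2_mul_subproof (A B : SL2) : \det (val A *m val B) == 1.
Proof. by rewrite det_mulmx !SL2_det mulr1. Qed.
Fact SL2_inv_subproof (A : SL2) : \det (invmx (val A)) == 1.
Proof. by rewrite det_inv SL2_det invr1. Qed.
Definition SL2_one : SL2 := Sub 1%:M SL2_one_subproof.
Definition SL2_mul (A B : SL2) : SL2 := Sub (val A *m val B) (SL2_mul_subproof A B).
Definition SL2_inv (A : SL2) : SL2 := Sub (invmx (val A)) (SL2_inv_subproof A).

Lemma SL2_mulA : associative SL2_mul.
Proof. by move=> A B C; apply: val_inj; rewrite /= mulmxA. Qed.
Lemma SL2_mul1 : left_id SL2_one SL2_mul.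
Proof. by move=> A; apply: val_inj; rewrite /= mul1mx. Qed.
Lemma SL2_mulr1 : right_id SL2_one SL2_mul.
Proof. by move=> A; apply: val_inj; rewrite /= mulmx1. Qed.
Lemma SL2_mulV : left_inverse SL2_one SL2_inv SL2_mul.
Proof. by move=> A; apply: val_inj; rewrite /= mulVmx // SL2_unit. Qed.
Lemma SL2_mulrV : right_inverse SL2_one SL2_inv SL2_mul.
Proof. by move=> A; apply: val_inj; rewrite /= mulmxV // SL2_unit. Qed.

HB.instance Definition _ :=
  isGroup.Build SL2 SL2_mulA SL2_mul1 SL2_mulr1 SL2_mulV SL2_mulrV.

Definition psl_equiv (A B : SL2) :=
  (val A == val B) || (val A == - val B).

Lemma psl_equiv_class : equiv_class_of psl_equiv.
Proof.
split=> [A|A B|B A C]; rewrite /psl_equiv ?eqxx //.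
  by rewrite eq_sym [X in _ || X]eq_sym eqr_oppLR.
case/orP=> /eqP ->; case/orP=> /eqP ->; rewrite ?opprK eqxx ?orbT //.
Qed.

Canonical psl_equiv_equiv := EquivRelPack psl_equiv_class.
Canonical psl_equiv_encModRel := defaultEncModRel psl_equiv.

Definition PSL2 := {eq_quot psl_equiv}.
HB.instance Definition _ : EqQuotient SL2 psl_equiv PSL2 :=
  EqQuotient.on PSL2.
HB.instance Definition _ := Choice.on PSL2.

Definition toPSL2 (A : SL2) : PSL2 := \pi_PSL2 A.

Lemma toPSL2_eq (A B : SL2) :
  toPSL2 A = toPSL2 B <-> val A = val B \/ val A = - val B.
Proof.
rewrite /toPSL2; split; last first.
  by move=> AB; apply/eqP; rewrite piE; apply/orP; case: AB => ->; [left|right].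
by move/eqP; rewrite piE => /orP[] /eqP ->; [left|right].
Qed.

Definition PSL2_one : PSL2 := toPSL2 SL2_one.
Definition PSL2_mul (x y : PSL2) : PSL2 := toPSL2 (repr x * repr y)%g.
Definition PSL2_inv (x : PSL2) : PSL2 := toPSL2 (repr x)^-1%g.

Lemma toPSL2_repr x : toPSL2 (repr x) = x. Proof. exact: reprK. Qed.

Lemma toPSL2_surj x : exists A, x = toPSL2 A.
Proof. by exists (repr x); rewrite toPSL2_repr. Qed.

Lemma repr_toPSL2 A :
  val (repr (toPSL2 A)) = val A \/ val (repr (toPSL2 A)) = - val A.
Proof. by apply/toPSL2_eq; rewrite toPSL2_repr. Qed.

Lemma toPSL2_mul_subproof A B :
  PSL2_mul (toPSL2 A) (toPSL2 B) = toPSL2 (A * B)%g.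
Proof.
apply/toPSL2_eq; rewrite /=.
case: (repr_toPSL2 A) => ->; case: (repr_toPSL2 B) => ->;
  rewrite ?mulNmx ?mulmxN ?opprK; by [left | right].
Qed.

Lemma toPSL2_inv_subproof A : PSL2_inv (toPSL2 A) = toPSL2 A^-1%g.
Proof.
apply/toPSL2_eq; rewrite /=.
case: (repr_toPSL2 A) => ->; [by left | right].
rewrite -scaleN1r invmxZ ?invrN1 ?scaleN1r //.
by rewrite unitmxE -scaleN1r detZ SL2_det sqrrN expr1n mulr1 unitr1.
Qed.

Lemma PSL2_mulA : associative PSL2_mul.
Proof.
move=> x y z; have [A ->] := toPSL2_surj x; have [B ->] := toPSL2_surj y.
have [C ->] := toPSL2_surj z.
by rewrite !toPSL2_mul_subproof mulgA.
Qed.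
Lemma PSL2_mul1 : left_id PSL2_one PSL2_mul.
Proof.
by move=> x; have [A ->] := toPSL2_surj x; rewrite toPSL2_mul_subproof mul1g.
Qed.
Lemma PSL2_mulr1 : right_id PSL2_one PSL2_mul.
Proof.
by move=> x; have [A ->] := toPSL2_surj x; rewrite toPSL2_mul_subproof mulg1.
Qed.
Lemma PSL2_mulV : left_inverse PSL2_one PSL2_inv PSL2_mul.
Proof.
move=> x; have [A ->] := toPSL2_surj x.
by rewrite toPSL2_inv_subproof toPSL2_mul_subproof mulVg.
Qed.
Lemma PSL2_mulrV : right_inverse PSL2_one PSL2_inv PSL2_mul.
Proof.
move=> x; have [A ->] := toPSL2_surj x.
by rewrite toPSL2_inv_subproof toPSL2_mul_subproof mulgV.
Qed.

HB.instance Definition _ :=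
  isGroup.Build PSL2 PSL2_mulA PSL2_mul1 PSL2_mulr1 PSL2_mulV PSL2_mulrV.

Lemma toPSL2M : {morph toPSL2 : A B / (A * B)%g}.
Proof. by move=> A B; rewrite -toPSL2_mul_subproof. Qed.

HB.instance Definition _ :=
  isMultiplicative.Build SL2 PSL2 toPSL2 toPSL2M.

End PSL2.

(* Upper half-space model of H^3: (x, y, t) is the point x + iy + tj. *)

Section Hyperbolic.
Variable R : realType.
Local Notation C := R[i].
Local Notation space :=
  (measurableTypeR R * measurableTypeR R * measurableTypeR R)%type.

Definition upper_half_space : set (R * R * R) := [set p | 0 < p.2].

Definition complex_norm2 (z : C) : R := complex.Re z ^+ 2 + complex.Im z ^+ 2.

(* Poincare extension of z |-> (a z + b) / (c z + d), for det A = 1. *)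
Definition poincare_extension (A : 'M[C]_2) (p : R * R * R) : R * R * R :=
  let z := (p.1.1 +i* p.1.2)%C in let t := p.2 in
  let a := A 0 0 in let b := A 0 1 in let c := A 1 0 in let d := A 1 1 in
  let den := complex_norm2 (c * z + d) + complex_norm2 c * t ^+ 2 in
  let num := (a * z + b) * conjc (c * z + d)
             + a * conjc c * ((t ^+ 2)%:C)%C in
  (complex.Re num / den, complex.Im num / den, t / den).

Implicit Types (Gamma : set (PSL2 C)) (D : set (R * R * R)).

Definition translates_cover Gamma D : Prop :=
  D `<=` upper_half_space /\
  forall p, upper_half_space p -> exists A : SL2 C,
    Gamma (toPSL2 A) /\ D (poincare_extension (val A) p).

Definition hyperbolic_volume D : \bar R :=
  (\int[(@lebesgue_measure R \x @lebesgue_measure R)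
         \x @lebesgue_measure R]_(p in (D : set space)) (p.2 ^- 3)%:E)%E.

(* For discrete Gamma this is the volume of the quotient: a measurable set
   whose translates cover has at least the volume of a fundamental domain. *)
Definition covolume Gamma : \bar R :=
  ereal_inf [set hyperbolic_volume D | D in
    [set D | measurable (D : set space) /\ translates_cover Gamma D]].

(* The identity is isolated, in the topology that PSL_2(C) inherits from the
   matrix entries. *)
Definition discrete_subgroup Gamma : Prop :=
  exists2 e : R, 0 < e & forall A : SL2 C, Gamma (toPSL2 A) ->
    (forall i j, complex_norm2 (val A i j - (1%:M : 'M[C]_2) i j) < e ^+ 2) ->
    toPSL2 A = 1%g.

Definition lattice Gamma : Prop :=
  discrete_subgroup Gamma /\ (covolume Gamma < +oo)%E.

Definition cocompact Gamma : Prop :=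
  exists2 K : set (R * R * R), compact K & translates_cover Gamma K.

Definition torsion_free Gamma : Prop :=
  forall x n, Gamma x -> (0 < n)%N -> (x ^+ n)%g = 1%g -> x = 1%g.

(* Gamma is the fundamental group of a closed orientable hyperbolic
   3-manifold, acting on H^3 by deck transformations. *)
Definition closed_hyperbolic_3manifold_group (Gamma : subgroup (PSL2 C)) :
    Prop :=
  [/\ discrete_subgroup Gamma, torsion_free Gamma & cocompact Gamma].

Definition weeks_group (Gamma : subgroup (PSL2 C)) : Prop :=
  closed_hyperbolic_3manifold_group Gamma /\
  forall Gamma' : subgroup (PSL2 C), closed_hyperbolic_3manifold_group Gamma' ->
    (covolume Gamma <= covolume Gamma')%E.

End Hyperbolic.

Section NumberField.
Variable k : fieldExtType rat.

Definition ring_of_integers : set k :=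
  [set x | integralOver (intr : int -> k) x].

Definition is_integral_basis (e : (\dim {:k}).-tuple k) : Prop :=
  [/\ basis_of {:k} e, forall i, ring_of_integers (tnth e i) &
      forall x, ring_of_integers x -> forall i, coord e i x \is a Num.int].

(* Trace of multiplication by x, computed in the basis e. *)
Definition basis_trace (e : (\dim {:k}).-tuple k) (x : k) : rat :=
  \sum_i coord e i (x * tnth e i).

Definition has_discriminant (D : int) : Prop :=
  exists2 e, is_integral_basis e &
    \det (\matrix_(i, j) basis_trace e (tnth e i * tnth e j)) = D%:~R.

End NumberField.

Section AbsoluteValues.
Variable R : realType.

Definition absolute_value (F : fieldType) (v : F -> R) : Prop :=
  [/\ forall x, 0 <= v x, forall x, v x = 0 <-> x = 0,
      forall x y, v (x * y) = v x * v y &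
      forall x y, v (x + y) <= v x + v y].

Definition nontrivial_abs (F : fieldType) (v : F -> R) : Prop :=
  exists2 x, x != 0 & v x != 1.

Definition nonarchimedean_abs (F : fieldType) (v : F -> R) : Prop :=
  forall x y, v (x + y) <= Num.max (v x) (v y).

Definition complete_abs (F : fieldType) (v : F -> R) : Prop :=
  forall u : nat -> F,
    (forall e, 0 < e -> exists N, forall m n,
       (N <= m)%N -> (N <= n)%N -> v (u m - u n) < e) ->
    exists l, forall e, 0 < e -> exists N, forall n,
      (N <= n)%N -> v (u n - l) < e.

Definition is_completion (F : fieldType) (v : F -> R)
    (L : fieldType) (w : L -> R) (iota : {rmorphism F -> L}) : Prop :=
  [/\ absolute_value w, complete_abs w, forall x, w (iota x) = v x &
      forall y e, 0 < e -> exists x, w (y - iota x) < e].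

(* v is equivalent to the absolute value of a real embedding. *)
Definition real_place (F : fieldType) (v : F -> R) : Prop :=
  exists tau : {rmorphism F -> R}, forall x, (v x < 1) = (`|tau x| < 1).

(* v is the place of a prime ideal P with #(O_k / P) = q; [s] is a system of
   representatives. *)
Definition finite_place_of_norm (k : fieldExtType rat) (v : k -> R) (q : nat) :
    Prop :=
  nonarchimedean_abs v /\
  exists s : seq k,
    [/\ uniq s, size s = q, forall y, y \in s -> ring_of_integers y &
        forall x, ring_of_integers x ->
          exists! y, y \in s /\ v (x - y) < 1].

End AbsoluteValues.

(* The quaternion algebra (a, b / F), with basis 1, i, j, ij and
   i^2 = a, j^2 = b, ij = - ji. *)

Record quaternion (F : comNzRingType) (a b : F) :=
  Quaternion { q0 : F; q1 : F; q2 : F; q3 : F }.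

Section Quaternion.
Variables (F : comNzRingType) (a b : F).
Local Notation H := (quaternion a b).
Local Notation Q := (@Quaternion F a b).
Implicit Types x y z : H.

Definition quat_tuple x := (q0 x, q1 x, q2 x, q3 x).
Definition tuple_quat (t : F * F * F * F) : H :=
  Q t.1.1.1 t.1.1.2 t.1.2 t.2.
Lemma quat_tupleK : cancel quat_tuple tuple_quat. Proof. by case. Qed.
HB.instance Definition _ := Choice.copy H (can_type quat_tupleK).

Definition quat_zero : H := Q 0 0 0 0.
Definition quat_one : H := Q 1 0 0 0.
Definition quat_opp x : H := Q (- q0 x) (- q1 x) (- q2 x) (- q3 x).
Definition quat_add x y : H :=
  Q (q0 x + q0 y) (q1 x + q1 y) (q2 x + q2 y) (q3 x + q3 y).
Definition quat_mul x y : H :=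
  Q (q0 x * q0 y + a * (q1 x * q1 y) + b * (q2 x * q2 y)
       - a * b * (q3 x * q3 y))
    (q0 x * q1 y + q1 x * q0 y - b * (q2 x * q3 y) + b * (q3 x * q2 y))
    (q0 x * q2 y + q2 x * q0 y + a * (q1 x * q3 y) - a * (q3 x * q1 y))
    (q0 x * q3 y + q3 x * q0 y + q1 x * q2 y - q2 x * q1 y).

Local Ltac quat := repeat case=> ? ? ? ?; congr Quaternion => /=; ring.

Lemma quat_addA : associative quat_add. Proof. quat. Qed.
Lemma quat_addC : commutative quat_add. Proof. quat. Qed.
Lemma quat_add0 : left_id quat_zero quat_add. Proof. quat. Qed.
Lemma quat_addN : left_inverse quat_zero quat_opp quat_add. Proof. quat. Qed.
HB.instance Definition _ :=
  GRing.isZmodule.Build H quat_addA quat_addC quat_add0 quat_addN.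

Lemma quat_mulA : associative quat_mul. Proof. quat. Qed.
Lemma quat_mul1 : left_id quat_one quat_mul. Proof. quat. Qed.
Lemma quat_mulr1 : right_id quat_one quat_mul. Proof. quat. Qed.
Lemma quat_mulDl : left_distributive quat_mul quat_add. Proof. quat. Qed.
Lemma quat_mulDr : right_distributive quat_mul quat_add. Proof. quat. Qed.
Lemma quat_one_neq0 : quat_one != 0.
Proof. by apply/eqP=> -[] /eqP; rewrite oner_eq0. Qed.
HB.instance Definition _ := GRing.Zmodule_isNzRing.Build H
  quat_mulA quat_mul1 quat_mulr1 quat_mulDl quat_mulDr quat_one_neq0.

Definition quat_scalar (c : F) : H := Q c 0 0 0.

Definition reduced_norm x : F :=
  q0 x ^+ 2 - a * q1 x ^+ 2 - b * q2 x ^+ 2 + a * b * q3 x ^+ 2.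

Definition division_algebra : Prop :=
  forall x, x != 0 -> exists y, x * y = 1 /\ y * x = 1.

End Quaternion.

(* (a, b / F) is ramified at the place v: its tensor product with the
   completion F_v, which is (a, b / F_v), is a division algebra. *)
Definition ramified_at (R : realType) (F : fieldType) (a b : F) (v : F -> R) :
    Prop :=
  exists (L : fieldType) (w : L -> R) (iota : {rmorphism F -> L}),
    is_completion v w iota /\ division_algebra (iota a) (iota b).

Section Orders.
Variables (k : fieldExtType rat) (a b : k).
Local Notation B := (quaternion a b).

Definition quat_span (A : set k) (s : seq B) : set B :=
  [set x | exists c : nat -> k, (forall i, A (c i)) /\
     x = \sum_(i < size s) quat_scalar a b (c i) * nth 0 s i].

(* O_k-orders of B: subrings that are finitely generated O_k-modules spanning
   B over k. *)
Definition is_order (O : set B) : Prop :=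
  [/\ O 1, forall x y, O x -> O y -> O (x * y) &
      exists2 s, O = quat_span (@ring_of_integers k) s &
        quat_span setT s = setT].

Definition is_maximal_order (O : set B) : Prop :=
  is_order O /\ forall O', is_order O' -> O `<=` O' -> O = O'.

(* Image in PSL_2 of the elements of O of reduced norm one, under a
   representation rho of B by matrices. *)
Definition norm_one_image (F : fieldType) (O : set B)
    (rho : {rmorphism B -> 'M[F]_2}) : set (PSL2 F) :=
  [set g | exists x : B, exists A : SL2 F,
     [/\ O x, reduced_norm x = 1, val A = rho x & g = toPSL2 A]].

End Orders.

(* Main.v *)
Require Import Defs.
From HB Require Import structures.
From mathcomp Require Import all_boot all_order all_algebra all_fingroup.
From mathcomp Require Import all_solvable all_field.
From mathcomp Require Import mathcomp_extra boolp classical_sets functions.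
From mathcomp Require Import generic_quotient ring_quotient.
From mathcomp Require Import reals zify ring.
From mathcomp.real_closed Require Import complex.
From mathcomp.multinomials Require Import freeg.

Set Implicit Arguments.
Unset Strict Implicit.
Unset Printing Implicit Defensive.

Import Order.TTheory GRing.Theory Num.Theory.

Local Open Scope classical_set_scope.
Local Open Scope quotient_scope.
Local Open Scope ring_scope.

(* Write G = Delta, N = Gamma_W and Q = G / N, a subgroup of the dihedral group of
   order 12. Two relators with exponent sums (5, 0) and (0, 5) on two generators
   give H_1(N) = (Z/5)^2 and, by Hopf's formula, H_2(N) = 0; as 5 is prime to the
   order of Q, H_2(G) is H_2(Q), which is Z/2 if the order of Q is divisible by 4
   and 0 otherwise.

   To see this on the bar complex, let M be the group of 2-chains modulo
   boundaries and E = M x G the central extension of G by M defined by the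
   universal cocycle (g, h) |-> [g|h]. The class of a 2-cycle lies in the
   intersection of M with [E, E]. Let X1 <= X2 <= E be the preimages of N and of
   the normal subgroup C of order 3. Counting exponents in words,
   M meets [X1, X1] trivially. Averaging over the quotients X2 / X1 and E / X2,
   whose orders are prime to 5 and 15, shows that M meets [X2, X1] = [X2, X2] and
   then [E, X2] trivially. If E / X2 is generated by the images of commuting
   elements r and s of G, then [E, E] is generated by [E, X2] and a central
   commutator of lifts of r and s, which is the class of [r|s] - [s|r]: so this
   class generates H_2(G). It vanishes for s = 1, and for the Klein four-group it
   has order 2, being detected by the product of two characters of order 2. *)

(** * Generated subgroups and commutator subgroups *)

Section Commutators.
Variable E : groupType.
Implicit Types (H D X Y : subgroup E) (S T : set E) (x y g : E).

Lemma sub_gen S : S `<=` gen S.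
Proof. by move=> x Sx H; apply. Qed.

Lemma gen_min S H : S `<=` H -> gen S `<=` H.
Proof. by move=> SH x; apply. Qed.

Lemma sg_expg H x n : sg_set H x -> sg_set H (x ^+ n)%g.
Proof.
move=> Hx; elim: n => [|n IHn]; first exact: sg_one.
by rewrite expgS; apply: sg_mul.
Qed.

Definition comm S T : subgroup E := gen [set [~ x, y]%g | x in S & y in T].

Lemma mem_comm S T x y : S x -> T y -> sg_set (comm S T) [~ x, y]%g.
Proof. by move=> Sx Ty; apply: sub_gen; exists x => //; exists y. Qed.

Lemma comm_min S T H :
  (forall x y, S x -> T y -> sg_set H [~ x, y]%g) -> comm S T `<=` H.
Proof. by move=> h; apply: gen_min => _ [x Sx [y Ty <-]]; apply: h. Qed.

Lemma comm_mono S S' T T' : S `<=` S' -> T `<=` T' -> comm S T `<=` comm S' T'.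
Proof. by move=> SS TT; apply: comm_min => x y /SS ? /TT ?; apply: mem_comm. Qed.

Definition normal_set S := forall x g, S x -> S (x ^ g)%g.

(** Induction over a generated subgroup goes through [gen_min], so each invariant has to be packaged
    as a subgroup. *)
Lemma conj_preim_one H g : [set x | sg_set H (x ^ g)%g] 1%g.
Proof. by rewrite /= conj1g; apply: sg_one. Qed.
Lemma conj_preim_mul H g x y : [set x | sg_set H (x ^ g)%g] x ->
  [set x | sg_set H (x ^ g)%g] y -> [set x | sg_set H (x ^ g)%g] (x * y)%g.
Proof. by rewrite /= conjMg; apply: sg_mul. Qed.
Lemma conj_preim_inv H g x :
  [set x | sg_set H (x ^ g)%g] x -> [set x | sg_set H (x ^ g)%g] x^-1%g.
Proof. by rewrite /= conjVg; apply: sg_inv. Qed.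
Definition conj_preim H g : subgroup E :=
  Subgroup (conj_preim_one H g) (@conj_preim_mul H g) (@conj_preim_inv H g).

Lemma comm_normal S T : normal_set S -> normal_set T -> normal_set (comm S T).
Proof.
move=> nS nT x g; apply: (comm_min (H := conj_preim (comm S T) g)) => y z Sy Tz.
by rewrite /= conjRg; apply: mem_comm; [apply: nS|apply: nT].
Qed.

Lemma commgMl x y z : ([~ x * y, z] = [~ x, z] ^ y * [~ y, z])%g.
Proof. by rewrite /commg /conjg !invgM !mulgA !mulgK. Qed.

Section CentralizerMod.
Variables (D : subgroup E) (nD : normal_set D) (z : E).
Lemma cent_mod_one : [set x | sg_set D [~ x, z]%g] 1%g.
Proof. by rewrite /= comm1g; apply: sg_one. Qed.
Lemma cent_mod_mul x y :
  [set x | sg_set D [~ x, z]%g] x -> [set x | sg_set D [~ x, z]%g] y ->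
  [set x | sg_set D [~ x, z]%g] (x * y)%g.
Proof. by rewrite /= commgMl => Dx Dy; apply: sg_mul => //; apply: nD. Qed.
Lemma cent_mod_inv x :
  [set x | sg_set D [~ x, z]%g] x -> [set x | sg_set D [~ x, z]%g] x^-1%g.
Proof.
rewrite /= => Dx; suff -> : [~ x^-1, z]%g = ([~ x, z]^-1 ^ x^-1)%g.
  by apply: nD; apply: sg_inv.
by rewrite /commg /conjg !(invgM, invgK, mulgA) mulgK.
Qed.
(** The preimage of the centralizer of z D in E / D, without forming the quotient group. *)
Definition cent_mod : subgroup E :=
  Subgroup cent_mod_one cent_mod_mul cent_mod_inv.
End CentralizerMod.

(** An element that commutes modulo [D] with the generators does so with all they generate; this is
    applied in one argument, then in the other. *)
Lemma comm_gen_sub T D : normal_set D ->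
  (forall x y, T x -> T y -> sg_set D [~ x, y]%g) -> comm (gen T) (gen T) `<=` D.
Proof.
move=> nD TD; apply: comm_min => x y Tx Ty.
apply: (gen_min (H := cent_mod nD y)) Tx => t Tt /=.
rewrite -invgR; apply: sg_inv.
by apply: (gen_min (H := cent_mod nD t)) Ty => u Tu /=; apply: TD.
Qed.

End Commutators.

(** * The abelianization of a subgroup, written additively *)

Section Abelianization.
Variables (E : groupType) (X : subgroup E).
Local Notation D := (comm X X).
Implicit Types u v w : sg_type X.

Lemma sg_typeP u : sg_set X (val u). Proof. by have /asboolP := valP u. Qed.

Lemma sg_val1 : val (1%g : sg_type X) = 1%g. Proof. exact: gmulf1. Qed.
Lemma sg_valM u v : val (u * v)%g = (val u * val v)%g. Proof. exact: gmulfM. Qed.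
Lemma sg_valV u : val (u^-1)%g = ((val u)^-1)%g. Proof. exact: gmulfV. Qed.

Lemma commX_sub : D `<=` X.
Proof.
apply: comm_min => x y Xx Xy; rewrite /commg /conjg.
by do !(apply: sg_mul => //; try apply: sg_inv).
Qed.

(** Since x ^ y = x [x, y], [X] normalizes [D] even when [X] is not normal in [E]. *)
Lemma commX_conj x y : sg_set D x -> sg_set X y -> sg_set D (x ^ y)%g.
Proof.
move=> Dx Xy; rewrite -(mulVKg x (x ^ y)%g) -commgEl.
by apply: sg_mul => //; apply: mem_comm => //; apply: commX_sub.
Qed.

Definition ab_equiv u v := `[< sg_set D ((val u)^-1 * val v)%g >].

Lemma ab_equiv_class : equiv_class_of ab_equiv.
Proof.
split=> [u|u v|v u w]; rewrite /ab_equiv.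
- by apply/asboolP; rewrite mulVg; apply: sg_one.
- by apply/asbool_equiv_eq; split=> /sg_inv; rewrite invgM invgK.
- move=> /asboolP uv /asboolP vw; apply/asboolP.
  by rewrite -(mulgK (val v) (val u)^-1%g) -mulgA; apply: sg_mul.
Qed.

Canonical ab_equiv_equiv := EquivRelPack ab_equiv_class.
Canonical ab_equiv_encModRel := defaultEncModRel ab_equiv.

Definition abelianization := {eq_quot ab_equiv}.
HB.instance Definition _ : EqQuotient (sg_type X) ab_equiv abelianization :=
  EqQuotient.on abelianization.
HB.instance Definition _ := Choice.on abelianization.

Local Notation V := abelianization.

Definition ab_pi u : V := \pi_V u.

Lemma ab_piP u v : ab_pi u = ab_pi v <-> sg_set D ((val u)^-1 * val v)%g.
Proof.
rewrite /ab_pi; split; last by move=> h; apply/eqP; rewrite piE; apply/asboolP.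
by move/eqP; rewrite piE => /asboolP.
Qed.

Definition ab_zero : V := ab_pi 1%g.
Definition ab_add (x y : V) : V := ab_pi (repr x * repr y)%g.
Definition ab_opp (x : V) : V := ab_pi (repr x)^-1%g.

Lemma ab_repr x : ab_pi (repr x) = x. Proof. exact: reprK. Qed.

Lemma ab_addE u v : ab_add (ab_pi u) (ab_pi v) = ab_pi (u * v)%g.
Proof.
apply/ab_piP; rewrite !sg_valM.
have /ab_piP := ab_repr (ab_pi u); have /ab_piP := ab_repr (ab_pi v).
set s := val (repr _); set t := val (repr _) => hs ht.
rewrite invgM -mulgA (mulgA t^-1)%g (conjgC (t^-1 * val u))%g mulgA.
by apply: sg_mul => //; apply: commX_conj => //; apply: sg_typeP.
Qed.

Lemma ab_addC' u v : ab_pi (u * v)%g = ab_pi (v * u)%g.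
Proof.
apply/ab_piP; rewrite !sg_valM invgM -mulgA.
have -> : ((val v)^-1 * ((val u)^-1 * (val v * val u)) = [~ val v, val u])%g by [].
by apply: mem_comm; apply: sg_typeP.
Qed.

Lemma ab_oppE u : ab_opp (ab_pi u) = ab_pi u^-1%g.
Proof.
have := ab_repr (ab_pi u); rewrite /ab_opp; set v := repr _ => /ab_piP uv.
apply/ab_piP; rewrite !sg_valV invgK.
move/sg_inv: (commX_conj uv (sg_inv (sg_typeP v))).
by rewrite /conjg !(invgM, invgK, mulgA) mulgK.
Qed.

Lemma ab_addA : associative ab_add.
Proof.
by move=> x y z; rewrite -(ab_repr x) -(ab_repr y) -(ab_repr z) !ab_addE mulgA.
Qed.
Lemma ab_addC : commutative ab_add.
Proof. by move=> x y; rewrite -(ab_repr x) -(ab_repr y) !ab_addE ab_addC'. Qed.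
Lemma ab_add0 : left_id ab_zero ab_add.
Proof. by move=> x; rewrite -(ab_repr x) ab_addE mul1g. Qed.
Lemma ab_addN : left_inverse ab_zero ab_opp ab_add.
Proof. by move=> x; rewrite -(ab_repr x) ab_oppE ab_addE mulVg. Qed.
HB.instance Definition _ :=
  GRing.isZmodule.Build abelianization ab_addA ab_addC ab_add0 ab_addN.

(* [ab] is a homomorphism on [X] only; it is extended by 0 outside [X]. *)
Definition ab (x : E) : V := ab_pi (insubd (1%g : sg_type X) x).

Lemma insubdX x : sg_set X x -> val (insubd (1%g : sg_type X) x) = x.
Proof. by move=> Xx; rewrite val_insubd ifT //; apply/asboolP. Qed.

Lemma abM x y : sg_set X x -> sg_set X y -> ab (x * y)%g = ab x + ab y.
Proof.
move=> Xx Xy; rewrite [RHS]ab_addE /ab; congr ab_pi; apply: val_inj.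
by rewrite sg_valM !insubdX //; apply: sg_mul.
Qed.

Lemma ab1 : ab 1%g = 0.
Proof.
by rewrite /ab; congr ab_pi; apply: val_inj; rewrite insubdX ?sg_val1 //; apply: sg_one.
Qed.

Lemma abV x : sg_set X x -> ab x^-1%g = - ab x.
Proof.
move=> Xx; apply/eqP; rewrite -addr_eq0 -abM ?mulVg ?ab1 //; exact: sg_inv.
Qed.

Lemma abX x n : sg_set X x -> ab (x ^+ n)%g = ab x *+ n.
Proof.
move=> Xx; elim: n => [|n IHn]; first by rewrite ab1.
by rewrite expgS mulrS abM ?IHn //; apply: sg_expg.
Qed.

Lemma ab_eq x y : sg_set X x -> sg_set X y ->
  ab x = ab y <-> sg_set D (x^-1 * y)%g.
Proof. by move=> Xx Xy; rewrite /ab ab_piP !insubdX. Qed.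

Lemma ab_eq0 x : sg_set X x -> ab x = 0 <-> sg_set D x.
Proof.
move=> Xx; rewrite -ab1 ab_eq //; last exact: sg_one.
by rewrite mulg1; split=> /sg_inv; rewrite ?invgK.
Qed.

Lemma abJ x y : sg_set X x -> sg_set X y -> ab (x ^ y)%g = ab x.
Proof.
by move=> Xx Xy; rewrite /conjg !abM ?abV ?(addrC (ab x)) ?addKr //;
   [apply: sg_inv | apply: sg_mul].
Qed.

End Abelianization.

(** * Coprime averaging *)

(* An element of [A] in [[Y, X]] is killed by [m], because the [m]-th power map
   [X -> A [X, X] / [X, X]] is invariant under conjugation, and by the order of
   [Y / X], because the sum of its conjugates in [X / [X, X]] is zero. *)
Section CoprimeAverage.
Variables (E : groupType) (X Y : subgroup E) (A : set E).
Hypotheses (nX : normal_set X) (AX : A `<=` X).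
Hypothesis (Acentral : forall a x, A a -> (a ^ x)%g = a).
Hypothesis (A_stem : forall a, A a -> sg_set (comm X X) a -> a = 1%g).

Variable (m : nat).
Hypothesis (expX : forall x, sg_set X x ->
  exists2 c, A c & sg_set (comm X X) (c^-1 * x ^+ m)%g).

Lemma ab_expJ x y : sg_set X x -> ab X (x ^ y)%g *+ m = ab X x *+ m.
Proof.
move=> Xx; have [c Ac cD] := expX Xx.
have Xxy := nX y Xx; have Xc := AX Ac.
rewrite -!abX // -conjXg.
have nD := comm_normal nX nX.
have -> : ab X (x ^+ m)%g = ab X c by symmetry; apply/ab_eq => //; apply: sg_expg.
symmetry; apply/ab_eq => //; first by apply: nX; apply: sg_expg.
by have := nD _ y cD; rewrite conjMg conjVg Acentral.
Qed.

Variables (Q : finGroupType) (f : E -> Q).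
Hypothesis (fM : forall x y, sg_set Y x -> sg_set Y y -> f (x * y)%g = (f x * f y)%g).
Hypothesis (f_ker : forall y, sg_set Y y -> f y = 1%g -> sg_set X y).

Let F : {set Q} := [set q | `[< exists2 y, sg_set Y y & f y = q >]].
Hypothesis (coprime_mF : coprime m #|F|).

Lemma rep_exists q : exists y, q \in F -> sg_set Y y /\ f y = q.
Proof.
case: (boolP (q \in F)) => [|_]; last by exists 1%g.
by rewrite inE => /asboolP [y Yy <-]; exists y.
Qed.

Let rep q := projT1 (cid (rep_exists q)).
Let repP q : q \in F -> sg_set Y (rep q) /\ f (rep q) = q.
Proof. exact: projT2 (cid (rep_exists q)). Qed.

(** Conjugation by [X] is trivial on X / [X, X], so the choice of representatives does not affect
    this sum. *)
Let norm x := \sum_(q in F) ab X (x ^ rep q)%g.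

Let normM x y : sg_set X x -> sg_set X y -> norm (x * y)%g = norm x + norm y.
Proof.
move=> Xx Xy; rewrite /norm -big_split /=; apply: eq_bigr => q _.
by rewrite conjMg abM //; apply: nX.
Qed.

Let fV y : sg_set Y y -> f (y^-1)%g = ((f y)^-1)%g.
Proof.
move=> Yy; apply/eqP; rewrite -mulg_eq1.
rewrite -fM //; last exact: sg_inv.
have f1 : f 1%g = 1%g.
  by apply: (mulgI (f 1%g)); rewrite -fM ?mulg1 //; apply: sg_one.
by rewrite mulVg f1.
Qed.

(** Left translation by [f y] permutes [F], and [y * rep q] differs from [rep (f y * q)] only by an
    element of [X]. *)
Let normJ x y : sg_set X x -> sg_set Y y -> norm (x ^ y)%g = norm x.
Proof.
move=> Xx Yy; rewrite /norm [RHS](reindex_inj (mulgI (f y))) /=.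
have FE q : (f y * q)%g \in F = (q \in F).
  rewrite !inE; apply/asbool_equiv_eq; split=> [[z Yz fz]|[z Yz <-]].
    exists (y^-1 * z)%g; first by apply: sg_mul => //; apply: sg_inv.
    by rewrite fM ?fV ?fz ?mulKg //; apply: sg_inv.
  by exists (y * z)%g; [apply: sg_mul|rewrite fM].
apply: eq_big => [q|q Fq]; first by rewrite FE.
have [Yr fr] := repP Fq; have := Fq; rewrite -FE => /repP [Yr' fr'].
have Yyr : sg_set Y (y * rep q)%g by apply: sg_mul.
rewrite -conjgM -(mulVKg (rep (f y * q))%g (y * rep q)%g) conjgM abJ //.
  exact: nX.
apply: f_ker; first by apply: sg_mul => //; apply: sg_inv.
by rewrite fM ?fV ?fr' ?fM ?fr ?mulVg //; apply: sg_inv.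
Qed.

Lemma ab_stem a : A a -> ab X a = 0 -> a = 1%g.
Proof. by move=> Aa /ab_eq0 h; apply: A_stem => //; apply: h; apply: AX. Qed.

Lemma norm_V x : sg_set X x -> norm x^-1%g = - norm x.
Proof.
move=> Xx; apply/eqP; rewrite -addr_eq0 -normM ?mulVg //; last exact: sg_inv.
by rewrite /norm big1 // => q _; rewrite conj1g ab1.
Qed.

(** Multiplication by [m] and [norm] are both invariant under conjugation by [Y], so both kill
    [Y, X]. On the central set [A], [norm] is multiplication by [#|F|], and Bezout combines the
    two. *)
Lemma coprime_stem a : A a -> sg_set (comm Y X) a -> a = 1%g.
Proof.
move=> Aa; pose K := [set x | [/\ sg_set X x, ab X x *+ m = 0 & norm x = 0]].
have K1 : K 1%g.
  split; first exact: sg_one; first by rewrite ab1 mul0rn.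
  by rewrite /norm big1 // => q _; rewrite conj1g ab1.
have KM x y : K x -> K y -> K (x * y)%g.
  move=> [Xx mx nx] [Xy my ny]; split; first exact: sg_mul.
    by rewrite abM // mulrnDl mx my addr0.
  by rewrite normM // nx ny addr0.
have KV x : K x -> K x^-1%g.
  move=> [Xx mx nx]; split; first exact: sg_inv.
    by rewrite abV // mulNrn mx oppr0.
  by rewrite norm_V // nx oppr0.
move=> /(comm_min (H := Subgroup K1 KM KV)) [|Xa ma].
  move=> y x Yy Xx; rewrite /= -invgR; apply: KV.
  have XJ := nX y Xx; rewrite commgEl; split.
  - by apply: sg_mul => //; apply: sg_inv.
  - by rewrite abM ?abV ?mulrnDl ?mulNrn ?ab_expJ ?addNr //; apply: sg_inv.
  - by rewrite normM ?norm_V ?normJ ?addNr //; apply: sg_inv.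
have -> : norm a = ab X a *+ #|F|.
  by rewrite /norm -sumr_const; apply: eq_bigr => q _; rewrite Acentral.
move=> na; apply: ab_stem => //.
(* For [m = 0] coprimality forces [#|F| = 1], and the norm alone suffices. *)
have [m0|m_gt0] := posnP m.
  by move: coprime_mF; rewrite m0 /coprime gcd0n => /eqP F1; rewrite F1 in na.
have [u v uv _] := egcdnP #|F| m_gt0.
move: (coprime_mF); rewrite /coprime => /eqP g1; rewrite g1 in uv.
have := congr1 (GRing.natmul (ab X a)) uv.
by rewrite mulnC mulrnA ma mul0rn mulrnDr mulr1n mulnC mulrnA na mul0rn add0r.
Qed.

End CoprimeAverage.

(** * Exponent sums of words and the Weeks relators *)

Section WeeksWords.
Local Open Scope ring_scope.

Definition expo (i : bool) (w : word bool) : int :=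
  \sum_(l <- w | l.1 == i) (if l.2 then -1 else 1).

Lemma expo_cat i u v : expo i (u ++ v) = expo i u + expo i v.
Proof. by rewrite /expo big_cat. Qed.

Definition winv (w : word bool) : word bool := rev [seq (l.1, ~~ l.2) | l <- w].

Lemma expo_winv i w : expo i (winv w) = - expo i w.
Proof.
elim: w => [|[j e] w IHw]; first by rewrite /expo !big_nil oppr0.
rewrite /winv /= rev_cons -cats1 expo_cat IHw /expo big_cons big_nil /=.
by rewrite big_cons /=; case: eqP => _; case: e => /=; lia.
Qed.

Section Eval.
Variables (E : groupType) (F : bool -> E).
Local Notation ev := (word_eval F).

Lemma word_eval_cat u v : ev (u ++ v) = (ev u * ev v)%g.
Proof. by rewrite /word_eval big_cat. Qed.

Lemma word_eval_winv w : ev (winv w) = ((ev w)^-1)%g.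
Proof.
elim: w => [|[j e] w IHw]; first by rewrite /word_eval !big_nil invg1.
rewrite /winv /= rev_cons -cats1 word_eval_cat IHw /word_eval.
rewrite !big_cons big_nil mulg1 invgM.
by rewrite /=; case: e; rewrite ?invgK.
Qed.

Lemma word_eval_range x : sg_set (gen (range F)) x -> exists w, x = ev w.
Proof.
pose S := [set y | exists w, y = ev w].
have S1 : S 1%g by exists [::]; rewrite /word_eval big_nil.
have SM y z : S y -> S z -> S (y * z)%g.
  by move=> [u ->] [v ->]; exists (u ++ v); rewrite word_eval_cat.
have SV y : S y -> S y^-1%g.
  by move=> [u ->]; exists (winv u); rewrite word_eval_winv.
apply: (gen_min (H := Subgroup S1 SM SV)) => _ [i _ <-] /=.
by exists [:: (i, false)]; rewrite /word_eval big_cons big_nil mulg1.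
Qed.

Let al := F false.
Let be := F true.
(** In a central extension the relators take values on lifts that need not be trivial, only
    central. *)
Let c1 := (al * al * be * be * al * al * (be * al^-1 * be)^-1)%g.
Let c2 := (be * be * al * al * be * be * (al * be^-1 * al)^-1)%g.
Hypotheses (c1_central : forall x, commute c1 x) (c2_central : forall x, commute c2 x).

(** Two natural exponents, one on each side of an equation, stand for an integer exponent. *)
Let k (i j : nat) := (c1 ^+ i * c2 ^+ j)%g.

Let kM i j i' j' : (k i j * k i' j')%g = k (i + i') (j + j').
Proof.
rewrite /k !expgnDr -!mulgA; congr (_ * _)%g; rewrite !mulgA; congr (_ * _)%g.
exact/commuteX/commute_sym/commuteX.
Qed.

(* The relators have exponent sums (5, 0) and (0, 5), so in a central extension
   the discrepancy between two lifts of the same element is read off from the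
   exponent sums of the words. *)
Lemma pres_eq_central u v : pres_eq weeks_relations u v ->
  exists i i' j j' : nat,
  [/\ expo false u + (5 * i)%:Z = expo false v + (5 * i')%:Z,
      expo true u + (5 * j)%:Z = expo true v + (5 * j')%:Z &
      (ev u * (c1 ^+ i * c2 ^+ j) = ev v * (c1 ^+ i' * c2 ^+ j'))%g].
Proof.
elim=> {u v}.
- by move=> u; exists 0%N, 0%N, 0%N, 0%N.
- by move=> u v _ [i [i' [j [j' [h1 h2 h3]]]]]; exists i', i, j', j.
- move=> u v w _ [i [i' [j [j' [h1 h2 h3]]]]] _ [l [l' [n [n' [h4 h5 h6]]]]].
  exists (i + l)%N, (i' + l')%N, (j + n)%N, (j' + n')%N; split; [lia|lia|].
  rewrite -!/(k _ _) in h3 h6 *.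
  rewrite -kM mulgA h3 -mulgA kM addnC (addnC j') -kM mulgA h6 -mulgA kM.
  by rewrite addnC (addnC n').
- move=> u v i e; exists 0%N, 0%N, 0%N, 0%N.
  rewrite !expo_cat !word_eval_cat; split.
  + by rewrite /expo !big_cons big_nil /=; case: i; case: e => /=; lia.
  + by rewrite /expo !big_cons big_nil /=; case: i; case: e => /=; lia.
  + rewrite !mulg1; congr (_ * _)%g; rewrite /word_eval !big_cons big_nil.
    by case: e; rewrite /= ?mulVg mulg1 ?mulgV ?mulVg mul1g.
- move=> u v l r [[-> ->]|[-> ->]].
  (* The sides differ by 4 - (-1) = 5 in the exponent sum of a, by 2 - 2 = 0 in that of b, and by
     the factor [c1] in value. *)
  + exists 0%N, 1%N, 0%N, 0%N; rewrite !expo_cat !word_eval_cat; split.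
    * by rewrite /expo !big_cons !big_nil /=; lia.
    * by rewrite /expo !big_cons !big_nil /=; lia.
    rewrite !mulg1 -!mulgA; congr (_ * _)%g.
    rewrite !expg1 -(c1_central (ev v)) mulgA -(c1_central _); congr (_ * _)%g.
    by rewrite /word_eval !big_cons !big_nil /= !mulg1 /c1 !gnorm.
  + exists 0%N, 0%N, 0%N, 1%N; rewrite !expo_cat !word_eval_cat; split.
    * by rewrite /expo !big_cons !big_nil /=; lia.
    * by rewrite /expo !big_cons !big_nil /=; lia.
    rewrite !mulg1 -!mulgA; congr (_ * _)%g.
    rewrite expg0 mul1g !expg1 -(c2_central (ev v)) mulgA -(c2_central _).
    congr (_ * _)%g.
    by rewrite /word_eval !big_cons !big_nil /= !mulg1 /c2 !gnorm.
Qed.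

End Eval.
End WeeksWords.

(** * Homomorphisms, and central extensions restricted to the Weeks group *)

Section GroupMorphism.
Variables (E P : groupType) (p : {multiplicative E -> P}).

Lemma morph_one : p 1%g = 1%g.
Proof. by apply: (mulgI (p 1%g)); rewrite -gmulfM !mulg1. Qed.

Lemma morph_inv x : p x^-1%g = (p x)^-1%g.
Proof. by apply/eqP; rewrite -mulg_eq1 -gmulfM mulVg morph_one. Qed.

Lemma morph_exp x n : p (x ^+ n)%g = (p x ^+ n)%g.
Proof. by elim: n => [|n IHn]; rewrite ?morph_one // !expgS gmulfM IHn. Qed.

Lemma morph_word_eval (I : Type) (F : I -> E) w :
  p (word_eval F w) = word_eval (p \o F) w.
Proof.
rewrite /word_eval (big_morph p (@gmulfM _ _ p) morph_one).
by apply: eq_bigr => l _; case: l.2; rewrite ?morph_inv.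
Qed.

End GroupMorphism.

(** The first relator in additive form, with exponent sums (5, 0); exchanging x and y gives the
    second. *)
Lemma weeks_relator_sum (V : zmodType) (x y : V) :
  x *+ 5 = x + x + y + y + x + x - (y - x + y).
Proof.
rewrite !opprD opprK !addrA [RHS](ACl (1*2*5*6*8*(3*7)*(4*9))) /= !subrr !addr0.
by rewrite !mulrS addr0 !addrA.
Qed.

Section WeeksCentralExtension.
Variables (E P : groupType) (p : {multiplicative E -> P}) (F : bool -> E).
Variable (X : subgroup E).
Local Notation A := [set x | p x = 1%g].
Local Notation ev := (word_eval F).
Hypothesis A_central : forall a x, A a -> (a ^ x)%g = a.
Hypothesis pres : forall u v, word_eval (p \o F) u = word_eval (p \o F) v <->
  pres_eq weeks_relations u v.
Hypothesis XE : forall x, sg_set X x <-> sg_set (gen (range (p \o F))) (p x).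

Let a_commute a x : A a -> commute a x.
Proof. by move=> /(A_central x) ax; rewrite /commute conjgC ax. Qed.

Let c1 := (F false * F false * F true * F true * F false * F false *
  (F true * (F false)^-1 * F true)^-1)%g.
Let c2 := (F true * F true * F false * F false * F true * F true *
  (F false * (F true)^-1 * F false)^-1)%g.

Let rel l r : weeks_relations (l, r) -> p (ev l * (ev r)^-1)%g = 1%g.
Proof.
move=> lr; have /pres h := pres_rel [::] [::] lr.
by rewrite gmulfM morph_inv !morph_word_eval /= !cats0 in h *; rewrite h mulgV.
Qed.

Let c1A : p c1 = 1%g.
Proof.
have := rel (or_introl (erefl _)); rewrite /word_eval !big_cons !big_nil /=.
by rewrite !mulg1 !mulgA.
Qed.

Let c2A : p c2 = 1%g.
Proof.
have := rel (or_intror (erefl _)); rewrite /word_eval !big_cons !big_nil /=.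
by rewrite !mulg1 !mulgA.
Qed.

Let XF i : sg_set X (F i).
Proof. by apply/XE; apply: sub_gen; exists i. Qed.

Let X_word x : sg_set X x ->
  exists2 w, A (x * (ev w)^-1)%g & x = (x * (ev w)^-1 * ev w)%g.
Proof.
move=> /XE /word_eval_range [w xw]; exists w; last by rewrite mulgVK.
by rewrite /= gmulfM morph_inv xw morph_word_eval mulgV.
Qed.

Let comm_mul_central c d x y : A c -> A d -> [~ c * x, d * y]%g = [~ x, y]%g.
Proof.
move=> Ac Ad; rewrite commgMl (_ : [~ c, _]%g = 1%g) ?conj1g ?mul1g; last first.
  by rewrite commgEl A_central // mulVg.
rewrite -invgR commgMl (_ : [~ d, _]%g = 1%g) ?conj1g ?mul1g ?invgR //.
by rewrite commgEl A_central // mulVg.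
Qed.

(** Central factors drop out of commutators, so an element of [X, X] is the value of a word with
    both exponent sums zero. If the value is in [A], the word is trivial in the presented group, and
    its discrepancy from 1, read off from the exponent sums, vanishes. *)
Lemma weeks_stem a : A a -> sg_set (comm X X) a -> a = 1%g.
Proof.
pose K := [set x | exists w, [/\ expo false w = 0, expo true w = 0 & x = ev w]].
have K1 : K 1%g by exists [::]; rewrite /expo /word_eval !big_nil.
have KM x y : K x -> K y -> K (x * y)%g.
  move=> [u [u0 u1 ->]] [v [v0 v1 ->]]; exists (u ++ v).
  by rewrite !expo_cat u0 u1 v0 v1 word_eval_cat.
have KV x : K x -> K x^-1%g.
  move=> [u [u0 u1 ->]]; exists (winv u).
  by rewrite !expo_winv u0 u1 word_eval_winv.
move=> Aa /(comm_min (H := Subgroup K1 KM KV)) [|w [w0 w1 aw]].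
  move=> x y /X_word [u Au ->] /X_word [v Av ->] /=.
  exists (winv u ++ winv v ++ u ++ v); rewrite !expo_cat !expo_winv.
  split; [lia|lia|rewrite comm_mul_central //].
  by rewrite !word_eval_cat !word_eval_winv.
have /pres/pres_eq_central : word_eval (p \o F) w = word_eval (p \o F) [::].
  by rewrite -morph_word_eval -aw Aa /word_eval big_nil.
move=> /(_ E F) [||i [i' [j [j' [e1 e2]]]]]; try by move=> x; apply: a_commute.
rewrite w0 w1 /expo !big_nil in e1 e2.
have -> : i' = i by lia.
have -> : j' = j by lia.
by move=> /mulIg h; rewrite aw h /word_eval big_nil.
Qed.

(** In the abelianization, five times a lifted generator is the class of a relator value, which lies
    in [A]. The property passes to products and inverses, and elements of [A] have it too. *)
Lemma weeks_exp5 x : sg_set X x ->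
  exists2 c, A c & sg_set (comm X X) (c^-1 * x ^+ 5)%g.
Proof.
have AX : A `<=` X by move=> a Aa; apply/XE; rewrite Aa; apply: sg_one.
pose K := [set y | sg_set X y /\ exists2 c, A c & ab X y *+ 5 = ab X c].
have K1 : K 1%g.
  by split; [exact: sg_one|exists 1%g; rewrite /= ?morph_one // ab1 mul0rn].
have KM y z : K y -> K z -> K (y * z)%g.
  move=> [Xy [c Ac yc]] [Xz [d Ad zd]]; split; first exact: sg_mul.
  exists (c * d)%g; first by rewrite /= gmulfM Ac Ad mulg1.
  by rewrite !abM ?mulrnDl ?yc ?zd //; apply: AX.
have KV y : K y -> K y^-1%g.
  move=> [Xy [c Ac yc]]; split; first exact: sg_inv.
  exists (c^-1)%g; first by rewrite /= morph_inv Ac invg1.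
  by rewrite !abV ?mulNrn ?yc //; apply: AX.
pose KK := Subgroup K1 KM KV.
have KA c : A c -> K c.
  move=> Ac; split; first exact: AX.
  exists (c ^+ 5)%g; first by rewrite /= morph_exp Ac expg1n.
  by rewrite abX //; apply: AX.
have KF i : K (F i).
  split; first exact: XF.
  exists (if i then c2 else c1); first by case: i.
  by case: i; rewrite ?/c1 ?/c2 !(abM, abV); do ?(apply: sg_mul || apply: sg_inv);
     rewrite ?XF //; apply: weeks_relator_sum.
move=> Xx; have [w Aw xw] := X_word Xx.
have [] : K x.
  rewrite xw; apply: (@sg_mul _ KK); first exact: KA.
  rewrite /word_eval; apply: big_ind => [|y z|[i e] _] /=; first exact: K1.
  - exact: (@sg_mul _ KK).
  - by case: e; [apply: (@sg_inv _ KK)|]; apply: KF.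
move=> _ [c Ac xc]; exists c => //; apply/ab_eq; [exact: AX|exact: sg_expg|].
by rewrite abX.
Qed.

End WeeksCentralExtension.

(** * The central extension defined by a 2-cocycle *)

Section CocycleExtension.
Variables (G : groupType) (M : zmodType) (c : G -> G -> M).

Definition cocycle := forall g h k : G,
  c h k - c (g * h)%g k + c g (h * k)%g - c g h = 0.

Hypothesis c_cocycle : cocycle.

(** The proof of the cocycle identity is a parameter of the type, so that a group structure can be
    attached to it. *)
Definition cocycle_ext of cocycle := (M * G)%type.
Local Notation E := (cocycle_ext c_cocycle).
HB.instance Definition _ := Choice.on E.

Lemma cocycle_mul g h k : c h k + c g (h * k)%g = c (g * h)%g k + c g h.
Proof.
by have /eqP := c_cocycle g h k; rewrite subr_eq0 addrAC subr_eq addrC => /eqP;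
   rewrite addrC [RHS]addrC.
Qed.

Lemma cocycle1l g : c 1%g g = c 1%g 1%g.
Proof. by have := cocycle_mul 1%g 1%g g; rewrite !mul1g => /addrI. Qed.

Lemma cocycle1r g : c g 1%g = c 1%g 1%g.
Proof. by have := cocycle_mul g 1%g 1%g; rewrite !mulg1 => /addIr. Qed.

Lemma cocycleV g : c g g^-1%g = c g^-1%g g.
Proof.
have := cocycle_mul g g^-1%g g.
by rewrite mulgV mulVg cocycle1l cocycle1r addrC => /addrI.
Qed.

Definition cext_mul (x y : E) : E := (x.1 + y.1 + c x.2 y.2, (x.2 * y.2)%g).
(** The cocycle is not assumed normalized: hence the terms [c 1 1] here, in the inverse and in
    [cext_incl]. *)
Definition cext_one : E := (- c 1%g 1%g, 1%g).
Definition cext_inv (x : E) : E :=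
  (- x.1 - c 1%g 1%g - c x.2^-1%g x.2, x.2^-1%g).

Lemma cext_mulA : associative cext_mul.
Proof.
move=> [m g] [n h] [o k]; rewrite /cext_mul /= mulgA; congr pair.
rewrite !addrA -[LHS]addrA cocycle_mul addrA addrAC.
by rewrite -!addrA; do 2 congr (_ + _); rewrite addrCA addrA.
Qed.
Lemma cext_mul1 : left_id cext_one cext_mul.
Proof.
by move=> [m g]; rewrite /cext_mul /= mul1g cocycle1l addrAC addNr add0r.
Qed.
Lemma cext_mulr1 : right_id cext_one cext_mul.
Proof. by move=> [m g]; rewrite /cext_mul /= mulg1 cocycle1r addrNK. Qed.
Lemma cext_mulV : left_inverse cext_one cext_inv cext_mul.
Proof.
move=> [m g]; rewrite /cext_mul /= mulVg; congr pair.
by rewrite addrAC addrNK addrAC addNr add0r.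
Qed.
Lemma cext_mulrV : right_inverse cext_one cext_inv cext_mul.
Proof.
move=> [m g]; rewrite /cext_mul /= mulgV cocycleV; congr pair.
by rewrite -addrA addrNK addrA addrN add0r.
Qed.
HB.instance Definition _ :=
  isGroup.Build E cext_mulA cext_mul1 cext_mulr1 cext_mulV cext_mulrV.

Lemma cext_mulE (x y : E) : (x * y)%g = (x.1 + y.1 + c x.2 y.2, (x.2 * y.2)%g).
Proof. by []. Qed.

Definition cext_proj (x : E) : G := x.2.
Lemma cext_projM : {morph cext_proj : x y / (x * y)%g}. Proof. by []. Qed.
HB.instance Definition _ := isMultiplicative.Build E G cext_proj cext_projM.

Definition cext_lift (g : G) : E := (0, g).
Definition cext_incl (m : M) : E := (m - c 1%g 1%g, 1%g).

Lemma cext_inclM m (x : E) : (cext_incl m * x)%g = (m + x.1, x.2) :> E.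
Proof.
case: x => n g; rewrite cext_mulE /= mul1g cocycle1l; congr pair.
by rewrite addrAC addrNK.
Qed.

Lemma cext_inclMr m (x : E) : (x * cext_incl m)%g = (cext_incl m * x)%g.
Proof.
rewrite cext_inclM; case: x => n g; rewrite cext_mulE /= mulg1 cocycle1r.
by congr pair; rewrite addrA addrNK addrC.
Qed.

Lemma cext_inclD m n : cext_incl (m + n) = (cext_incl m * cext_incl n)%g.
Proof. by rewrite cext_inclM /cext_incl /= addrA. Qed.

Lemma cext_incl0 : cext_incl 0 = 1%g.
Proof. by rewrite /cext_incl sub0r. Qed.

Lemma cext_inclN m : cext_incl (- m) = (cext_incl m)^-1%g.
Proof. by apply/eqP; rewrite -mulg_eq1 -cext_inclD addNr cext_incl0. Qed.

Lemma cext_incl_inj m : cext_incl m = 1%g -> m = 0.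
Proof. by rewrite -cext_incl0 => -[/addIr]. Qed.

Lemma cext_kerP (x : E) : cext_proj x = 1%g <-> exists m, x = cext_incl m.
Proof.
split=> [|[m ->]] //; case: x => m g /= ->; exists (m + c 1%g 1%g).
by rewrite /cext_incl addrK.
Qed.

Lemma cext_central (a x : E) : cext_proj a = 1%g -> (a ^ x)%g = a.
Proof. by move=> /cext_kerP [m ->]; rewrite /conjg -cext_inclMr mulKg. Qed.

Lemma cext_liftM g h :
  (cext_lift g * cext_lift h)%g = (cext_incl (c g h) * cext_lift (g * h))%g.
Proof. by rewrite cext_inclM cext_mulE /= add0r addr0 add0r. Qed.

(** The lift of g h = h g cancels, and the difference of the two cocycle values remains. *)
Lemma cext_comm_lift g h : commute g h ->
  [~ cext_lift g, cext_lift h]%g = cext_incl (c g h - c h g).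
Proof.
move=> gh; rewrite /commg /conjg mulgA -invgM !cext_liftM -gh invgM.
rewrite -cext_inclN -mulgA [X in (_ * X)%g]mulgA -cext_inclD addrC.
exact: cext_central.
Qed.

End CocycleExtension.

(** * Low-degree bar chains and the universal cocycle *)

Section BarChains.
Variable G : groupType.

Lemma bar_chain_ind n (P : bar_chain G n -> Prop) :
  P 0 -> (forall x y, P x -> P y -> P (x - y)) ->
  (forall t, P << t >>) -> forall x, P x.
Proof.
move=> P0 PB PU x; elim/freeg_ind_dom0: x => [//|k t x _ _ Px].
have PN y : P y -> P (- y) by rewrite -sub0r; apply: PB.
have PD y z : P y -> P z -> P (y + z).
  by move=> Py /PN Pz; rewrite -[z]opprK; apply: PB.
have Pn j : P (<< t >> *+ j).
  by elim: j => [|j IHj]; rewrite ?mulr0n // mulrS; apply: PD.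
apply: PD => //; rewrite -[k]intz -freegU_mulz; case: k => j; first exact: Pn.
by apply: PN; apply: Pn.
Qed.

Section Lift.
Variables (n : nat) (V : zmodType) (f : n.-tuple G -> V).

(** [zmodule] turns [V] into the Z-module that [fglift] expects. *)
Definition chain_lift (x : bar_chain G n) : V := fglift (f : _ -> zmodule V) x.

Lemma chain_lift_zmod : zmod_morphism chain_lift.
Proof. by move=> x y; rewrite /chain_lift lift_is_additive. Qed.
HB.instance Definition _ :=
  GRing.isZmodMorphism.Build (bar_chain G n) V chain_lift chain_lift_zmod.

Lemma chain_liftU t : chain_lift << t >> = f t.
Proof. by rewrite /chain_lift liftU scale1r. Qed.

End Lift.

Definition bar1 (g : G) : bar_chain G 1 := << [tuple g] >>.
Definition bar2 (g h : G) : bar_chain G 2 := << [tuple g; h] >>.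
Definition bar3 (g h k : G) : bar_chain G 3 := << [tuple g; h; k] >>.

Lemma tuple2E (t : 2.-tuple G) : t = [tuple tnth t ord0; tnth t ord_max].
Proof.
apply: eq_from_tnth => -[[|[|//]] i]; by rewrite !(tnth_nth 1%g) /= ?(tnth_nth 1%g).
Qed.

Lemma bar_diff2 g h : bar_diff (bar2 g h) = bar1 h - bar1 (g * h)%g + bar1 g.
Proof.
rewrite /= /bar_diffS liftU scale1r !big_ord_recl big_ord0 addr0 /=.
rewrite expr0 /bump /= expr1 exprS expr1 mulrNN mulr1 -freegUN !addrA.
set F0 := bar_face _ _; set F1 := bar_face _ _; set F2 := bar_face _ _.
have -> : F0 = [tuple h].
  by apply: eq_from_tnth => i; rewrite ord1 tnth_mktuple !(tnth_nth 1%g).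
have -> : F1 = [tuple (g * h)%g].
  by apply: eq_from_tnth => i; rewrite ord1 tnth_mktuple !(tnth_nth 1%g).
have -> // : F2 = [tuple g].
by apply: eq_from_tnth => i; rewrite ord1 tnth_mktuple !(tnth_nth 1%g).
Qed.

Lemma bar_diff3 g h k :
  bar_diff (bar3 g h k) =
  bar2 h k - bar2 (g * h)%g k + bar2 g (h * k)%g - bar2 g h.
Proof.
rewrite /= /bar_diffS liftU scale1r !big_ord_recl big_ord0 addr0 /=.
rewrite expr0 /bump /= !exprS expr0 !mulr1 mulrNN mulr1 -!freegUN !addrA.
set F0 := bar_face _ _; set F1 := bar_face _ _.
set F2 := bar_face _ _; set F3 := bar_face _ _.
have -> : F0 = [tuple h; k].
  by apply: eq_from_tnth => -[[|[|//]] i]; rewrite tnth_mktuple !(tnth_nth 1%g).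
have -> : F1 = [tuple (g * h)%g; k].
  by apply: eq_from_tnth => -[[|[|//]] i]; rewrite tnth_mktuple !(tnth_nth 1%g).
have -> : F2 = [tuple g; (h * k)%g].
  by apply: eq_from_tnth => -[[|[|//]] i]; rewrite tnth_mktuple !(tnth_nth 1%g).
have -> // : F3 = [tuple g; h].
by apply: eq_from_tnth => -[[|[|//]] i]; rewrite tnth_mktuple !(tnth_nth 1%g).
Qed.

Definition bar_bound : {pred bar_chain G 2} :=
  [pred x | `[< exists y : bar_chain G 3, bar_diff y = x >]].

Lemma bar_bound_closed : zmod_closed bar_bound.
Proof.
split=> [|x y]; first by apply/asboolP; exists 0; rewrite raddf0.
move=> /asboolP [u <-] /asboolP [v <-]; apply/asboolP; exists (u - v).
exact: raddfB.
Qed.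

HB.instance Definition _ :=
  GRing.isZmodClosed.Build (bar_chain G 2) bar_bound bar_bound_closed.

(* 2-chains modulo boundaries: the target of the universal 2-cocycle. *)
Definition bar_coker := Quotient.quot bar_bound.

Definition bar_cls (x : bar_chain G 2) : bar_coker := \pi_bar_coker x.

Lemma bar_cls_zmod : zmod_morphism bar_cls.
Proof. by move=> x y; rewrite /bar_cls !piE. Qed.
HB.instance Definition _ :=
  GRing.isZmodMorphism.Build (bar_chain G 2) bar_coker bar_cls bar_cls_zmod.

Lemma bar_cls_eq0 x : bar_cls x = 0 <-> exists y : bar_chain G 3, bar_diff y = x.
Proof.
rewrite -(raddf0 bar_cls) /bar_cls; split.
  by move/eqP; rewrite -Quotient.idealrBE subr0 => /asboolP.
by move=> h; apply/eqP; rewrite -Quotient.idealrBE subr0; apply/asboolP.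
Qed.

Definition univ_cocycle g h := bar_cls (bar2 g h).

Lemma univ_cocycleP : cocycle univ_cocycle.
Proof.
move=> g h k; rewrite /univ_cocycle -!raddfB -raddfD -raddfB.
by apply/bar_cls_eq0; exists (bar3 g h k); rewrite bar_diff3.
Qed.

Definition bar_ext := cocycle_ext univ_cocycleP.

Definition full : subgroup bar_ext :=
  @Subgroup bar_ext setT I (fun _ _ _ _ => I) (fun _ _ => I).

Local Notation incl := (@cext_incl _ _ _ univ_cocycleP).
Local Notation lift := (@cext_lift _ _ _ univ_cocycleP).

(* In the abelianization of the extension, [g|h] becomes g + h - gh. *)
Lemma bar_cycle_comm x : bar_diff x = 0 ->
  sg_set (comm full full) (incl (bar_cls x)).
Proof.
pose psi : {additive bar_chain G 1 -> abelianization full} :=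
  chain_lift (fun t : 1.-tuple G => ab full (lift (tnth t ord0))).
have psiE : ab full (incl (bar_cls x)) = psi (bar_diff x).
  elim/bar_chain_ind: x => [|x y hx hy|t].
  - by rewrite !raddf0 cext_incl0 ab1.
  - by rewrite !raddfB cext_inclD cext_inclN abM // abV // hx hy.
  - rewrite (tuple2E t); set g := tnth t _; set h := tnth t _.
    rewrite bar_diff2 raddfD raddfB /bar1 /psi /= !chain_liftU !(tnth_nth 1%g) /=.
    rewrite addrAC (addrC (ab _ _)) -abM // cext_liftM abM // addrK.
    by [].
by move=> dx; apply/ab_eq0 => //; rewrite psiE dx raddf0.
Qed.

End BarChains.

(** * A generator of the second homology, by averaging twice *)

Section Preimage.
Variables (E : groupType) (Q : finGroupType) (f : {multiplicative E -> Q}).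
Variable (H : {group Q}).

Lemma fin_preim_one : [set x | f x \in H] 1%g.
Proof. by rewrite /= morph_one group1. Qed.
Lemma fin_preim_mul x y :
  [set x | f x \in H] x -> [set x | f x \in H] y -> [set x | f x \in H] (x * y)%g.
Proof. by rewrite /= gmulfM; apply: groupM. Qed.
Lemma fin_preim_inv x : [set x | f x \in H] x -> [set x | f x \in H] x^-1%g.
Proof. by rewrite /= morph_inv groupV. Qed.
Definition fin_preim : subgroup E :=
  Subgroup fin_preim_one fin_preim_mul fin_preim_inv.

Lemma fin_preim_normal : (H <| [set: Q]%SET)%g -> normal_set fin_preim.
Proof.
move=> nH x g /= Hx; rewrite /conjg !gmulfM morph_inv -conjgE memJ_norm //.
by rewrite (fintype.subsetP (normal_norm nH)) // inE.
Qed.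

End Preimage.

Section SchurMultiplier.
Variables (G : groupType) (F : bool -> G) (Q : finGroupType).
Variables (f : {multiplicative G -> Q}) (C : {group Q}).
Hypothesis pres : forall u v, word_eval F u = word_eval F v <->
  pres_eq weeks_relations u v.
Hypothesis f_ker : forall g, f g = 1%g <-> sg_set (gen (range F)) g.
Hypotheses (C_normal : (C <| [set: Q]%SET)%g) (card_C : #|C| = 3%N).
Hypothesis (card_Q : #|[set: Q]%SET| = 12%N).

Local Notation E := (bar_ext G).
Local Notation incl := (@cext_incl _ _ _ (univ_cocycleP (G := G))).
Local Notation lift := (@cext_lift _ _ _ (univ_cocycleP (G := G))).
Let p : {multiplicative E -> G} := @cext_proj _ _ _ (univ_cocycleP (G := G)).
Let fE : {multiplicative E -> Q} := f \o p.
Let A : set E := [set x | p x = 1%g].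
(** [f] is not assumed onto: X2 / X1 has order 1 or 3, and the order of E / X2 divides 4. *)
Let X1 := fin_preim fE 1%G.
Let X2 := fin_preim fE C.
Let Y := full G.

Let X1P x : sg_set X1 x <-> fE x = 1%g.
Proof. by rewrite /X1 /= inE; split=> /eqP. Qed.

Let A_central a x : A a -> (a ^ x)%g = a. Proof. exact: cext_central. Qed.

Let AX1 : A `<=` X1.
Proof. by move=> a Aa; apply/X1P; rewrite /fE /= Aa morph_one. Qed.

Let X12 : X1 `<=` X2.
Proof. by move=> x /X1P; rewrite /= => ->; rewrite group1. Qed.

Let nX1 : normal_set X1.
Proof. by apply: fin_preim_normal; rewrite normal1. Qed.
Let nX2 : normal_set X2.
Proof. exact: fin_preim_normal. Qed.
Let nY : normal_set Y. Proof. by []. Qed.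

Let X1E x : sg_set X1 x <-> sg_set (gen (range (p \o (lift \o F)))) (p x).
Proof. by rewrite X1P; apply: f_ker. Qed.

Let stem1 a : A a -> sg_set (comm X1 X1) a -> a = 1%g.
Proof. exact: (@weeks_stem E G p (lift \o F) X1 A_central pres X1E a). Qed.

Let exp1 x : sg_set X1 x ->
  exists2 c, A c & sg_set (comm X1 X1) (c^-1 * x ^+ 5)%g.
Proof. exact: (@weeks_exp5 E G p (lift \o F) X1 pres X1E x). Qed.

Let stem21 a : A a -> sg_set (comm X2 X1) a -> a = 1%g.
Proof.
apply: (coprime_stem nX1 AX1 A_central stem1 exp1 (f := fE)).
- by move=> x y _ _; rewrite gmulfM.
- by move=> y _ /X1P.
(* [S] is the image of [X2] and lies in [C]; each of 1, 2, 3 is prime to 5. *)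
set S := [set q | _]%SET.
have S1 : (0 < #|S|)%N.
  apply/card_gt0P; exists 1%g; rewrite inE; apply/asboolP.
  by exists 1%g; [exact: sg_one|exact: morph_one].
have S3 : (#|S| <= 3)%N.
  rewrite -card_C; apply/subset_leq_card/fintype.subsetP => q; rewrite inE.
  by move=> /asboolP [y Yy <-].
by case: #|S| S1 S3 => [|[|[|[|]]]].
Qed.

(** X2 / X1 is cyclic, so [X2] is generated by [X1] and one element t; apart from [t, t] = 1, every
    commutator of generators involves [X1]. *)
Let comm22 : comm X2 X2 `<=` comm X2 X1.
Proof.
have [t Xt tC] : exists2 t, sg_set X2 t &
    forall y, sg_set X2 y -> fE y \in <[fE t]>%g.
  (* An element with nontrivial image generates [C], as 3 is prime; if there is none, t = 1 will
     do. *)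
  case: (pselect (exists2 y, sg_set X2 y & fE y != 1%g)) => [[t Xt ft]|h].
    exists t => // y Xy; suff -> : <[fE t]>%g = C by [].
    apply/eqP; rewrite eqEcard cycle_subG Xt card_C -orderE /=.
    have : (#[fE t]%g %| 3)%N by rewrite -card_C order_dvdG.
    rewrite dvdn_divisors // !inE => /orP [|/eqP ->] //.
    by rewrite order_eq1 (negPf ft).
  exists 1%g => [|y Xy]; first exact: sg_one.
  case: (eqVneq (fE y) 1%g) => [->|fy]; first exact: group1.
  by case: h; exists y.
pose T : set E := X1 `|` [set t].
have X2T : X2 `<=` gen T.
  move=> y Xy; have /cycleP [i fy] := tC y Xy.
  rewrite -(mulVKg (t ^+ i)%g y); apply: sg_mul.
    by apply: sg_expg; apply: sub_gen; right.
  apply: sub_gen; left; apply/X1P.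
  by rewrite gmulfM morph_inv morph_exp fy mulVg.
apply: subset_trans (comm_mono X2T X2T) _.
have nD : normal_set (comm X2 X1) by apply: comm_normal.
apply: comm_gen_sub => // x y [Xx|->] [Xy|->].
- by apply: mem_comm => //; apply: X12.
- by rewrite -invgR; apply/sg_inv/mem_comm.
- exact: mem_comm.
- by rewrite commgg; apply: sg_one.
Qed.

Let stem2 a : A a -> sg_set (comm X2 X2) a -> a = 1%g.
Proof. by move=> Aa /comm22; apply: stem21. Qed.

(** Cubing brings [X2] into [X1]; the factor 5 then comes from [exp1]. *)
Let exp2 x : sg_set X2 x ->
  exists2 c, A c & sg_set (comm X2 X2) (c^-1 * x ^+ (3 * 5)%N)%g.
Proof.
move=> Xx; have /exp1 [c Ac cx] : sg_set X1 (x ^+ 3)%g.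
  by apply/X1P; rewrite morph_exp -card_C expg_cardG.
by exists c => //; rewrite expgnA; apply: (comm_mono X12 X12).
Qed.

Let stemY a : A a -> sg_set (comm Y X2) a -> a = 1%g.
Proof.
pose fC (x : E) := coset C (fE x).
have nC g : g \in 'N(C)%g by rewrite (fintype.subsetP (normal_norm C_normal)) // inE.
have fCM x y : fC (x * y)%g = (fC x * fC y)%g.
  by rewrite /fC gmulfM morphM ?nC.
have fC1 : fC 1%g = 1%g by rewrite /fC morph_one morph1.
apply: (coprime_stem nX2 (subset_trans AX1 X12) A_central stem2 exp2 (f := fC)).
- by move=> x y _ _; apply: fCM.
- by move=> y _ /(coset_idr (nC _)).
(* The image is a subgroup of Q / C, so its order divides 4 and is prime to 15. *)
set S := [set q | _]%SET.
have gS : group_set S.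
  apply/group_setP; split; first by rewrite inE; apply/asboolP; exists 1%g.
  move=> x y; rewrite !inE => -[u _ ux] [v _ vy].
  by exists (u * v)%g; rewrite // fCM ux vy.
have /cardSg : Group gS \subset ([set: Q]%SET / C)%G.
  apply/fintype.subsetP => q; rewrite inE => /asboolP [u _ <-].
  by apply: mem_quotient; rewrite inE.
rewrite card_quotient ?normal_norm // -divgS ?normal_sub // card_C card_Q /=.
by move=> /coprime_dvdr; apply.
Qed.

Variables r s : G.
Hypothesis rs : commute r s.
Hypothesis G_gen : forall g, exists i j : nat,
  f ((r ^+ i * s ^+ j)^-1 * g)%g \in C.

Let zeta := univ_cocycle r s - univ_cocycle s r.

(** All commutators of generators of [E] lie in the normal subgroup [D], the product of [E, X2] and
    the multiples of [zeta]. By [stemY] the part in [E, X2] of a cycle class is trivial. *)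
Lemma bar_cycle_multiple x : bar_diff x = 0 ->
  exists n : int, bar_cls x = zeta *~ n.
Proof.
move=> dx; have := bar_cycle_comm dx.
pose D := [set y : E | exists n : int, sg_set (comm Y X2) (incl (zeta *~ n) * y)%g].
have D1 : D 1%g by exists 0; rewrite mulr0z cext_incl0 mulg1; apply: sg_one.
have DM y z : D y -> D z -> D (y * z)%g.
  move=> [m hm] [n hn]; exists (m + n).
  rewrite mulrzDr cext_inclD mulgA -(mulgA _ _ y) -(cext_inclMr _ y).
  by rewrite mulgA -mulgA; apply: sg_mul.
have DV y : D y -> D y^-1%g.
  move=> [m hm]; exists (- m); rewrite mulrNz cext_inclN.
  by rewrite -invgM cext_inclMr; apply: sg_inv.
pose DD := Subgroup D1 DM DV.
have nD : normal_set DD.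
  move=> y g [n hn]; exists n.
  have := comm_normal nY nX2 g hn; rewrite conjMg A_central //.
have commD y : sg_set (comm Y X2) y -> D y.
  by move=> h; exists 0; rewrite mulr0z cext_incl0 mul1g.
pose T : set E := X2 `|` [set lift r; lift s].
have YT : Y `<=` gen T.
  move=> y _; have [i [j fC]] := G_gen (p y).
  have Tr : sg_set (gen T) (lift r) by apply: sub_gen; right; left.
  have Ts : sg_set (gen T) (lift s) by apply: sub_gen; right; right.
  rewrite -(mulVKg (lift r ^+ i * lift s ^+ j)%g y); apply: sg_mul.
    by apply: sg_mul; apply: sg_expg.
  have pX (x0 : E) n : (x0 ^+ n)%g.2 = (x0.2 ^+ n)%g := morph_exp p x0 n.
  by apply: sub_gen; left; rewrite /= !pX.
have Deps : D [~ lift r, lift s]%g.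
  exists (-1); rewrite cext_comm_lift // mulrN1z -cext_inclD addNr cext_incl0.
  exact: sg_one.
have XD y z : sg_set X2 y -> D [~ z, y]%g by move=> Xy; apply/commD/mem_comm.
have DR y z : D [~ y, z]%g -> D [~ z, y]%g.
  by move=> h; rewrite -invgR; apply: (@sg_inv _ DD).
move=> /(comm_mono YT YT) /(comm_gen_sub (D := DD) nD) [|n].
  move=> y z [Xy|[->|->]] [Xz|[->|->]] /=; try (exact: XD); try (exact/DR/XD);
    rewrite ?commgg //; [exact: DR].
rewrite -cext_inclD => /stemY h; exists (- n).
have /cext_incl_inj/eqP : incl (zeta *~ n + bar_cls x) = 1%g by apply: h.
by rewrite addrC addr_eq0 => /eqP ->; rewrite mulrNz.
Qed.

End SchurMultiplier.

(** As [x, y] is central, [x, y]^2 = [x^2, y]; here x^2 lies over r^2 = 1 and is central too. *)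
Lemma univ_cocycle_commutator_involution (G : groupType) (r s : G) :
  commute r s -> (r ^+ 2 = 1)%g -> (univ_cocycle r s - univ_cocycle s r) *+ 2 = 0.
Proof.
move=> rs r2; apply: (@cext_incl_inj _ _ _ (univ_cocycleP (G := G))).
rewrite mulr2n cext_inclD -cext_comm_lift //.
set x := cext_lift _ _; set y := cext_lift _ _.
have xx : cext_proj (x * x)%g = 1%g by rewrite -r2 expg2.
have <- : [~ x * x, y]%g = 1%g by rewrite commgEl (cext_central y xx) mulVg.
rewrite commgMl; congr (_ * _)%g; rewrite cext_comm_lift //.
by rewrite cext_central.
Qed.

(** * Detecting the second homology by a cup product *)

Section SecondHomology.
Variable G : groupType.

(** Moves from cycles to all chains modulo boundaries, where the universal cocycle takes its
    values. *)
Lemma homology2_eq0 (z : bar_cycles G 2) :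
  \pi_(group_homology G 2) z = 0 <-> bar_cls (val z) = 0.
Proof.
rewrite bar_cls_eq0 -[0](raddf0 \pi_(group_homology G 2)); split.
  by move/eqP; rewrite -Quotient.idealrBE subr0 => /asboolP.
by move=> h; apply/eqP; rewrite -Quotient.idealrBE subr0; apply/asboolP.
Qed.

Lemma homology2_zero : (forall x : bar_chain G 2, bar_diff x = 0 -> bar_cls x = 0) ->
  forall x : group_homology G 2, x = 0.
Proof.
move=> h x; rewrite -[x]reprK; apply/homology2_eq0/h.
exact/eqP/(valP (repr x)).
Qed.

Lemma tuple3E (t : 3.-tuple G) :
  t = [tuple tnth t ord0; tnth t (inord 1); tnth t ord_max].
Proof.
apply: eq_from_tnth => -[[|[|[|//]]] i]; rewrite !(tnth_nth 1%g) /= ?(tnth_nth 1%g) //.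
by rewrite inordK.
Qed.

Variables (chi1 chi2 : G -> 'Z_2) (r s : G).
Hypothesis chi1M : forall g h, chi1 (g * h)%g = chi1 g + chi1 h.
Hypothesis chi2M : forall g h, chi2 (g * h)%g = chi2 g + chi2 h.
Hypotheses (chi1r : chi1 r = 1) (chi1s : chi1 s = 0).
Hypotheses (chi2r : chi2 r = 0) (chi2s : chi2 s = 1).
Hypotheses (rs : commute r s) (r2 : (r ^+ 2 = 1)%g).
Hypothesis gen_zeta : forall x : bar_chain G 2, bar_diff x = 0 ->
  exists n : int, bar_cls x = (univ_cocycle r s - univ_cocycle s r) *~ n.

(* A product of two characters is a 2-cocycle; this one detects the class of
   [r|s] - [s|r]. *)
Let cup : {additive bar_chain G 2 -> 'Z_2} :=
  chain_lift (fun t : 2.-tuple G => chi1 (tnth t ord0) * chi2 (tnth t ord_max)).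

Let cup2 g h : cup (bar2 g h) = chi1 g * chi2 h.
Proof. by rewrite /bar2 /cup /= chain_liftU !(tnth_nth 1%g). Qed.

Let cup_boundary (y : bar_chain G 3) : cup (bar_diff y) = 0.
Proof.
elim/bar_chain_ind: y => [|x y hx hy|t]; first by rewrite !raddf0.
  by rewrite !raddfB hx hy subrr.
rewrite (tuple3E t) -/(bar3 _ _ _) bar_diff3 raddfB raddfD raddfB !cup2 chi1M chi2M.
by ring.
Qed.

Let cup_cls x : bar_cls x = 0 -> cup x = 0.
Proof. by move=> /bar_cls_eq0 [y <-]. Qed.

Let zeta : bar_chain G 2 := bar2 r s - bar2 s r.

Let zeta_cycle : bar_diff zeta == 0.
Proof.
have -> : bar_diff zeta = bar_diff (bar2 r s) - bar_diff (bar2 s r) by exact: raddfB.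
rewrite !bar_diff2 rs; apply/eqP.
by rewrite [X in X - _]addrC addrCA [X in X - _]addrC subrr.
Qed.

Let cup_zeta : cup zeta = 1.
Proof. by rewrite /zeta raddfB !cup2 chi1r chi1s chi2r mul0r subr0 chi2s mulr1. Qed.

Let cupH (x : group_homology G 2) : 'Z_2 := cup (val (repr x)).

(** Two representatives differ by a boundary, on which [cup] vanishes. *)
Let cupHE z : cupH (\pi_(group_homology G 2) z) = cup (val z).
Proof.
apply/eqP; rewrite -subr_eq0 /cupH -raddfB; apply/eqP/cup_cls.
have := homology2_eq0 (repr (\pi_(group_homology G 2) z) - z).
by rewrite !raddfB /= reprK subrr => -[->].
Qed.

Let cupH_zmod : zmod_morphism cupH.
Proof.
move=> x y; rewrite -[x]reprK -[y]reprK -raddfB !cupHE.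
by rewrite !raddfB.
Qed.

Let int_parity (n : int) : exists m : int, n = m * 2 \/ n = m * 2 + 1.
Proof.
exists (n %/ 2)%Z; have := divz_eq n 2.
by have := modz_ge0 n (d := 2) isT; have := ltz_mod n (d := 2) isT; lia.
Qed.

(** A class is n times that of [zeta], and [cup] reads off n modulo 2. An even multiple is zero
    because r is an involution, and [zeta] itself maps to 1. *)
Lemma homology2_Z2 : zmod_isog (group_homology G 2) 'Z_2.
Proof.
pose phi : {additive group_homology G 2 -> 'Z_2} :=
  HB.pack cupH (GRing.isZmodMorphism.Build _ _ cupH cupH_zmod).
have inj : injective phi.
  apply: raddf_inj => x; rewrite /= -[x]reprK cupHE => hx.
  apply/homology2_eq0; set z := val (repr x).
  have [n zn] : exists n : int, bar_cls z = (univ_cocycle r s - univ_cocycle s r) *~ n.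
    by apply: gen_zeta; apply/eqP/(valP (repr x)).
  have zn0 : bar_cls (z - zeta *~ n) = 0.
    by rewrite raddfB raddfMz /= zn /zeta raddfB subrr.
  have := cup_cls zn0; rewrite raddfB raddfMz /= cup_zeta hx sub0r => /eqP.
  rewrite oppr_eq0 zn; have [m [->|->]] := int_parity n => [_|].
    rewrite mulrC mulrzA; set e := univ_cocycle r s - _.
    suff -> : e *~ 2 = 0 by rewrite mul0rz.
    exact: (univ_cocycle_commutator_involution rs r2).
  rewrite mulrzDr mulrC mulrzA.
  have -> : 1 *~ 2 = 0 :> 'Z_2 by apply/val_inj.
  by rewrite mul0rz add0r oner_eq0.
exists phi.
have surj k : exists x, phi x = k.
  case: (eqVneq k 0) => [->|k0]; first by exists 0; rewrite raddf0.
  exists (\pi_(group_homology G 2) (Sub zeta zeta_cycle : bar_cycles G 2)).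
  rewrite [LHS]cupHE [LHS]cup_zeta.
  by apply/val_inj; case: k k0 => -[|[|]].
exists (fun k => projT1 (cid (surj k))) => [x|k].
  by apply: inj; rewrite (projT2 (cid (surj _))).
exact: projT2 (cid (surj _)).
Qed.

End SecondHomology.

(** * Involutions and groups of order twelve *)

Lemma involutions_commute (E : groupType) (x y : E) :
  (x ^+ 2 = 1)%g -> (y ^+ 2 = 1)%g -> ((x * y) ^+ 2 = 1)%g -> commute x y.
Proof.
move=> x2 y2 xy2; have inv (u : E) : (u ^+ 2 = 1)%g -> (u^-1 = u)%g.
  by move=> u2; apply: mulg1_eq; rewrite -expg2.
by rewrite /commute -{1}(inv _ xy2) invgM (inv _ x2) (inv _ y2).
Qed.

Section OrderTwelve.
Local Open Scope group_scope.
Local Open Scope nat_scope.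
Implicit Type Q : finGroupType.

Lemma dihedral12_normal3 :
  exists2 C : {group 'D_12}, (C <| [set: 'D_12]%SET)%g & #|C| = 3.
Proof.
have : ([set: 'D_12]%SET \homg Grp (x : y : x ^+ 6, y ^+ 2, x ^ y = x^-1))%g.
  by rewrite -(@Grp_dihedral 6) ?homg_refl.
case/existsP=> -[x y] /=; rewrite !xpair_eqE => /and4P [].
move=> /eqP defG /eqP x6 /eqP y2 /eqP xy.
have nxy : <[y]>%g \subset 'N(<[x]>)%g.
  by rewrite norms_cycle xy groupV cycle_id.
have cardG : #|(<[x]> <*> <[y]>)%g| = 12 by rewrite defG (@card_dihedral 6).
(* The product formula gives [#[x] * #[y] >= 12], while the factors are at most 6 and 2. *)
have ox : #[x]%g = 6.
  have ox6 : #[x]%g %| 6 by rewrite order_dvdn x6.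
  have oy2 : #[y]%g <= 2 by rewrite dvdn_leq // order_dvdn y2.
  have := mul_cardG <[x]>%G <[y]>%G; rewrite /= -norm_joinEr // cardG -!orderE.
  have := cardG_gt0 (<[x]> :&: <[y]>)%G.
  have := dvdn_leq (isT : 0 < 6) ox6; rewrite /=; move: #|_| => n; nia.
(* This subgroup is normal: x centralizes it and y inverts it. *)
exists <[x ^+ 2]>%G; last by rewrite /= -orderE orderXdiv ox.
rewrite /normal finset.subsetT -defG join_subG !norms_cycle.
by rewrite conjXg conjgE mulKg cycle_id conjXg xy expVgn groupV cycle_id.
Qed.

(** For g outside [H], the disjoint cosets [H] and g^-1 H fill the group, so any h outside [H] has g
    h in [H]. *)
Lemma index2_memM Q (H : {group Q}) : #|[set: Q]%SET| = 2 * #|H| ->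
  forall g h : Q, ((g * h)%g \in H) = ((g \in H) == (h \in H)).
Proof.
move=> cardQ g h; case: (boolP (g \in H)) => gH; first by rewrite groupMl.
case: (boolP (h \in H)) => hH; first by rewrite groupMr // (negPf gH).
have : h \in (H :|: g^-1 *: H)%g.
  suff -> : (H :|: g^-1 *: H)%g = [set: Q]%SET by rewrite inE.
  apply/eqP; rewrite eqEcard finset.subsetT cardQ /= finset.cardsU card_lcoset.
  suff -> : (H :&: g^-1 *: H = finset.set0)%g by rewrite finset.cards0 subn0 mul2n addnn.
  apply/finset.setP => u; rewrite !inE mem_lcoset invgK; apply/negP => /andP [uH].
  by rewrite groupMr // (negPf gH).
by rewrite inE (negPf hH) mem_lcoset invgK /= => ->.
Qed.

Lemma index2_char Q (H : {group Q}) : #|[set: Q]%SET| = 2 * #|H| ->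
  exists2 chi : Q -> 'Z_2, (forall g h, chi (g * h)%g = (chi g + chi h)%R) &
    forall g, chi g = (g \notin H)%:R%R.
Proof.
move=> cardQ; exists (fun g => (g \notin H)%:R%R) => // g h.
rewrite index2_memM //; case: (g \in H); case: (h \in H) => //=;
  by rewrite ?addr0 ?add0r //; apply/val_inj.
Qed.

Section Klein.
Variables (Q : finGroupType) (C : {group Q}).
Hypothesis card_Q : #|[set: Q]%SET| = 12.
Hypotheses (C_normal : (C <| [set: Q]%SET)%g) (card_C : #|C| = 3).
Variables rho sigma : Q.
Hypotheses (rho2 : (rho ^+ 2 = 1)%g) (sigma2 : (sigma ^+ 2 = 1)%g).
Hypothesis rhosigma2 : ((rho * sigma) ^+ 2 = 1)%g.
Hypotheses (rho_neq1 : rho != 1%g) (sigma_neq1 : sigma != 1%g).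
Hypothesis rho_neq_sigma : rho != sigma.

Definition klein : {group Q} := (<[rho]> <*> <[sigma]>)%G.

Lemma klein_commute : commute rho sigma.
Proof. exact: involutions_commute. Qed.

Lemma order_involution (x : Q) : (x ^+ 2 = 1)%g -> x != 1%g -> #[x]%g = 2.
Proof. by move=> x2 x1; apply: nt_prime_order. Qed.

Lemma kleinE : klein = (<[rho]> * <[sigma]>)%g :> {set Q}.
Proof. by rewrite /= cent_joinEr //; apply/cents_cycle/commute_sym/klein_commute. Qed.

Lemma klein_elt v : v \in klein -> exists i j, v = (rho ^+ i * sigma ^+ j)%g.
Proof.
rewrite -[_ \in _]/(v \in (klein : {set Q})) kleinE.
by case/mulsgP => _ _ /cycleP [i ->] /cycleP [j ->] ->; exists i, j.
Qed.

Lemma card_klein : #|klein| = 4.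
Proof.
rewrite kleinE TI_cardMg /= -?orderE ?order_involution //.
apply: prime_TIg; first by rewrite -orderE order_involution.
rewrite cycle_subG /= cycle2g ?order_involution // !inE negb_or rho_neq1.
exact: rho_neq_sigma.
Qed.

(** The orders 4 and 3 are coprime with product 12, so [klein] is a complement of [C]. *)
Lemma klein_complement g : exists i j, ((rho ^+ i * sigma ^+ j)^-1 * g)%g \in C.
Proof.
have cop : coprime #|klein| #|C| by rewrite card_klein card_C.
have KC : (klein * C)%g = [set: Q]%SET.
  apply/eqP; rewrite eqEcard finset.subsetT card_Q TI_cardMg ?coprime_TIg //.
  by rewrite card_klein card_C.
have : g \in [set: Q]%SET by rewrite inE.
rewrite -KC => /mulsgP [v c /klein_elt [i [j ->]] cC ->].
by exists i, j; rewrite mulKg.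
Qed.

(** The kernel is <sigma> C, of order 6; containing rho as well, it would contain klein C, which is
    everything. *)
Lemma klein_char : exists2 chi : Q -> 'Z_2,
  (forall g h, chi (g * h)%g = (chi g + chi h)%R) &
  chi rho = 1%R /\ chi sigma = 0%R.
Proof.
pose H := (<[sigma]> <*> C)%G.
have HE : H = (<[sigma]> * C)%g :> {set Q}.
  rewrite /= norm_joinEl //; apply: fintype.subset_trans _ (normal_norm C_normal).
  exact: finset.subsetT.
have cardH : #|H| = 6.
  by rewrite HE TI_cardMg ?coprime_TIg // -?orderE order_involution // card_C.
have [|chi chiM chiE] := @index2_char Q H; first by rewrite cardH.
have sH : sigma \in H.
  by rewrite (fintype.subsetP (joing_subl _ _)) // cycle_id.
have CH : C \subset H by apply: joing_subr.
exists chi => //; rewrite !chiE sH; split=> //.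
suff -> : rho \notin H by [].
apply/negP => rH; have : [set: Q]%SET \subset H.
  apply/fintype.subsetP => g _; have [i [j gC]] := klein_complement g.
  rewrite -(mulVKg (rho ^+ i * sigma ^+ j)%g g) groupM //.
    by rewrite groupM // groupX.
  exact: (fintype.subsetP CH).
by move=> /subset_leq_card; rewrite card_Q cardH.
Qed.

(** The image of [D] in Q / C, a group of order 4, is cyclic or everything. Cyclic is the last
    alternative. Otherwise [D] has order 12 or 4, and in the latter case it is a Sylow 2-subgroup,
    as [klein] is. *)
Lemma klein_trichotomy (D : {group Q}) :
  [\/ D = [set: Q]%SET :> {set Q},
      exists x, D = (klein :^ x)%g :> {set Q} |
      exists2 t, t \in D & forall g, g \in D -> exists i, ((t ^+ i)^-1 * g)%g \in C].
Proof.
have nC (H : {group Q}) : H \subset 'N(C)%g.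
  by apply: fintype.subset_trans _ (normal_norm C_normal); apply: finset.subsetT.
have [cyc|ncyc] := boolP (cyclic (D / C)%g).
  apply: Or33; case/cyclicP: cyc => u Du.
  have : u \in (D / C)%g by rewrite Du cycle_id.
  case/morphimP => t nt tD ut; exists t => // g gD.
  have : coset C g \in <[u]>%g by rewrite -Du mem_quotient.
  case/cycleP => i gi; exists i.
  have gN h : h \in 'N(C)%g by rewrite (fintype.subsetP (normal_norm C_normal)) // inE.
  apply: (coset_idr (gN _)).
  by rewrite morphM ?morphV ?morphX ?gN //= gi -ut mulVg.
have card4 : #|(D / C)%g| = 4.
  have /cardSg : (D / C)%g \subset ([set: Q]%SET / C)%g by apply/quotientS/finset.subsetT.
  rewrite [#|([set: Q]%SET / C)%g|]card_quotient ?normal_norm //.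
  rewrite -divgS ?normal_sub // card_Q card_C.
  rewrite -[12 %/ 3]/4 dvdn_divisors // !inE => /or3P [/eqP d1|/eqP d2|/eqP //].
    by case/negP: ncyc; rewrite (card1_trivg d1) cyclic1.
  by case/negP: ncyc; apply: prime_cyclic; rewrite d2.
have cDC : #|D :&: C| \in [:: 1; 3].
  have : #|D :&: C| %| 3 by rewrite -card_C cardSg ?subsetIr.
  by rewrite dvdn_divisors // !inE.
have cardD : #|D| = 4 * #|D :&: C|.
  by rewrite -card4 card_quotient // mulnC LagrangeI.
move: cDC; rewrite !inE => /orP [/eqP c1|/eqP c3]; last first.
  apply: Or31; apply/eqP; rewrite eqEcard finset.subsetT card_Q cardD c3 //.
apply: Or32; rewrite c1 in cardD.
have syl (H : {group Q}) : #|H| = 4 -> 2.-Sylow([set: Q]%SET)%g H.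
  by move=> H4; rewrite pHallE finset.subsetT card_Q H4 p_part; vm_compute.
have [x _ ->] := Sylow_trans (syl klein card_klein) (syl D cardD).
by exists x.
Qed.

End Klein.
End OrderTwelve.

(** * Overgroups of the Weeks group and subgroups of the dihedral group *)

Section SubgroupInclusion.
Variables (P : groupType) (H K : subgroup P) (HK : H `<=` K).

Definition sg_incl (x : sg_type H) : sg_type K :=
  Sub (val x) (asboolT (HK (sg_typeP x))).

Lemma sg_inclM : {morph sg_incl : x y / (x * y)%g}.
Proof. by move=> x y; apply: val_inj; rewrite sg_valM. Qed.
HB.instance Definition _ :=
  isMultiplicative.Build (sg_type H) (sg_type K) sg_incl sg_inclM.

End SubgroupInclusion.

Definition sg_elt (P : groupType) (H : subgroup P) x (Hx : sg_set H x) : sg_type H :=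
  Sub x (asboolT Hx).

Lemma word_eval_gen (I : Type) (E : groupType) (F : I -> E) w :
  sg_set (gen (range F)) (word_eval F w).
Proof.
apply: (big_ind (sg_set (gen (range F)))) => [|x y|[i e] _].
- exact: sg_one.
- exact: sg_mul.
- by case: e; [apply: sg_inv|]; apply: sub_gen; exists i.
Qed.

Section WeeksOvergroups.
Variables (P : groupType) (GO W Delta : subgroup P) (a b r s : P).
Local Notation gens := (fun i : bool => if i then b else a).
Hypothesis W_pres : is_presentation weeks_relations gens W.
Hypothesis W_torsion_free :
  forall x n, sg_set W x -> (0 < n)%N -> (x ^+ n)%g = 1%g -> x = 1%g.
Variable f : {multiplicative sg_type GO -> 'D_12}.
Hypothesis f_surj : forall q, exists x, f x = q.
Hypothesis f_ker : forall x, f x = 1%g <-> sg_set W (val x).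
Hypotheses (GO_r : sg_set GO r) (GO_s : sg_set GO s).
Hypotheses (r_a : (r * a * r^-1 = a^-1)%g) (r_b : (r * b * r^-1 = b^-1)%g).
Hypothesis s_a : (s * a * s^-1 = b)%g.
Hypotheses (r_sq : (r ^+ 2 = 1)%g) (s_sq : (s ^+ 2 = 1)%g).
Hypothesis rs_sq : ((r * s) ^+ 2 = 1)%g.
Hypotheses (W_Delta : W `<=` Delta) (Delta_GO : Delta `<=` GO).

(** An invariant of elements of [W] that tells the generators and their inverses apart. *)
Let expo_mod5 u v : word_eval gens u = word_eval gens v ->
  exists n : int, expo false u - expo false v = 5 * n.
Proof.
case: W_pres => _ pres /pres uv.
have c1 (x y : P) : x = 1%g -> commute x y by move=> ->; rewrite /commute !gsimp.
(* Evaluating at the constant 1 makes the centrality conditions trivial and keeps the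
   congruences. *)
have [||i [i' [_ [_ [e _ _]]]]] := @pres_eq_central P (fun=> 1%g) _ _ u v uv;
  try by move=> x; apply: c1; rewrite !gsimp.
by exists (i'%:Z - i%:Z); lia.
Qed.

(** The exponent sums of a differ by 1 or 2, not a multiple of 5. *)
Let a_neq (l : bool * bool) : l != (false, false) ->
  a <> word_eval gens [:: l].
Proof.
move=> l1 al; have [|n] := @expo_mod5 [:: (false, false)] [:: l].
  by rewrite -al /word_eval big_cons big_nil mulg1.
by rewrite /expo !big_cons !big_nil /=; case: l l1 {al} => -[] [] //= _; lia.
Qed.

Let fr := f (sg_elt GO_r).
Let fs := f (sg_elt GO_s).

(** An involution in the torsion-free group [W] would be trivial; r = 1 would give a = a^-1, and
    likewise s = 1 would give a = b. *)
Let fr_neq1 : fr != 1%g.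
Proof.
apply/eqP => /f_ker /= Wr; have r1 := W_torsion_free Wr (isT : (0 < 2)%N) r_sq.
apply: (@a_neq (false, true)) => //.
by rewrite /word_eval big_cons big_nil /= mulg1 -r_a r1 !gsimp.
Qed.

Let fs_neq1 : fs != 1%g.
Proof.
apply/eqP => /f_ker /= Ws; have s1 := W_torsion_free Ws (isT : (0 < 2)%N) s_sq.
apply: (@a_neq (true, false)) => //.
by rewrite /word_eval big_cons big_nil /= mulg1 -s_a s1 !gsimp.
Qed.

Let fr2 : (fr ^+ 2 = 1)%g.
Proof.
rewrite -morph_exp; have -> : (sg_elt GO_r ^+ 2 = 1)%g by apply: val_inj; exact: r_sq.
exact: morph_one.
Qed.

Let fs2 : (fs ^+ 2 = 1)%g.
Proof.
rewrite -morph_exp; have -> : (sg_elt GO_s ^+ 2 = 1)%g by apply: val_inj; exact: s_sq.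
exact: morph_one.
Qed.

Let frs2 : ((fr * fs) ^+ 2 = 1)%g.
Proof.
rewrite -gmulfM -morph_exp.
have -> : ((sg_elt GO_r * sg_elt GO_s) ^+ 2 = 1)%g by apply: val_inj; exact: rs_sq.
exact: morph_one.
Qed.

(** Equal images would put r s in [W], whence r s = 1 and a = b^-1. *)
Let fr_neq_fs : fr != fs.
Proof.
apply/eqP => frs.
have /f_ker /= Wrs : f (sg_elt GO_r * sg_elt GO_s)%g = 1%g.
  by rewrite gmulfM -/fr -/fs -frs -expg2 fr2.
have rs1 := W_torsion_free Wrs (isT : (0 < 2)%N) rs_sq.
apply: (@a_neq (true, true)) => //.
rewrite /word_eval big_cons big_nil /= mulg1 -r_b -s_a !mulgA rs1 mul1g.
by rewrite -!mulgA -invgM rs1 !gsimp.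
Qed.

Let G := sg_type Delta.
Let fG : {multiplicative G -> 'D_12} := f \o sg_incl Delta_GO.

Let W_ab : sg_set W = sg_set (gen (range gens)). Proof. by case: W_pres. Qed.

Let W_gen i : sg_set W (gens i).
Proof. by rewrite W_ab; apply: sub_gen; exists i. Qed.

Let F i : G := sg_elt (W_Delta (W_gen i)).

Let val_word w : val (word_eval F w) = word_eval gens w.
Proof. exact: (morph_word_eval (val : {multiplicative G -> P})). Qed.

Let presG u v : word_eval F u = word_eval F v <-> pres_eq weeks_relations u v.
Proof.
case: W_pres => _ pres; rewrite -pres -!val_word.
by split=> [->//|]; apply: val_inj.
Qed.

Let fG_W x : fG x = 1%g <-> sg_set W (val x).
Proof. exact: f_ker. Qed.

Let fG_ker x : fG x = 1%g <-> sg_set (gen (range F)) x.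
Proof.
rewrite fG_W W_ab; split=> /word_eval_range [w xw].
  rewrite (_ : x = word_eval F w); first exact: word_eval_gen.
  by apply: val_inj; rewrite val_word.
by rewrite xw val_word; apply: word_eval_gen.
Qed.

Let card_D12 : #|[set: 'D_12]%SET| = 12%N.
Proof. exact: (@card_dihedral 6). Qed.

Let S := gen (W `|` [set r; s]).

Let Delta_image q : (exists2 x, sg_set Delta (val x) & f x = q) <-> exists x, fG x = q.
Proof.
split=> [[x Dx <-]|[x <-]]; last by exists (sg_incl Delta_GO x) => //; apply: sg_typeP.
by exists (sg_elt Dx); congr (f _); apply: val_inj.
Qed.

(** [Delta] contains the kernel [W], so it is the full preimage of its image. *)
Let Delta_mem x : sg_set Delta (val x) <-> exists y, fG y = f x.
Proof.
split=> [Dx|[y fy]]; first by apply/Delta_image; exists x.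
have Wx : sg_set W (val ((sg_incl Delta_GO y)^-1 * x)%g).
  have fy' : f (sg_incl Delta_GO y) = f x := fy.
  by apply/f_ker; rewrite gmulfM morph_inv fy' mulVg.
have := sg_mul (sg_typeP y) (W_Delta Wx).
by rewrite sg_valM sg_valV /= mulVKg.
Qed.

Let image_set : {set 'D_12} := [set q | `[< exists x, fG x = q >]].

Let image_group_set : group_set image_set.
Proof.
apply/group_setP; split.
  by rewrite inE; apply/asboolP; exists 1%g; exact: (morph_one fG).
move=> x y; rewrite !inE => -[u <-] [v <-]; exists (u * v)%g.
exact: (@gmulfM _ _ fG).
Qed.
Let D : {group 'D_12} := Group image_group_set.
Let DP q : q \in D <-> exists x, fG x = q.
Proof. by rewrite inE; split=> [/asboolP|h]; [|apply/asboolP]. Qed.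

Let exceptional := Delta = GO :> set P \/
  exists2 g, sg_set GO g & Delta = conj_set g S :> set P.

(** An element with image fr^i fs^j differs from r^i s^j by an element of [W], which [S]
    contains. *)
Let S_klein (x : sg_type GO) : sg_set S (val x) <-> f x \in klein fr fs.
Proof.
have [rK sK] : fr \in klein fr fs /\ fs \in klein fr fs.
  split; first by rewrite (fintype.subsetP (joing_subl _ _)) // cycle_id.
  by rewrite (fintype.subsetP (joing_subr _ _)) // cycle_id.
pose T := [set y : P | exists2 u : sg_type GO, val u = y & f u \in klein fr fs].
have T1 : T 1%g by exists 1%g; [exact: sg_val1|rewrite morph_one group1].
have TM y z : T y -> T z -> T (y * z)%g.
  move=> [u <- fu] [v <- fv]; exists (u * v)%g; first exact: sg_valM.
  by rewrite gmulfM groupM.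
have TV y : T y -> T y^-1%g.
  move=> [u <- fu]; exists (u^-1)%g; first exact: sg_valV.
  by rewrite morph_inv groupV.
split.
  move=> /(gen_min (H := Subgroup T1 TM TV)) [y|u ux fu]; last first.
    by rewrite -(val_inj ux).
  move=> [Wy|[->|->]].
  - exists (sg_elt (Delta_GO (W_Delta Wy))) => //.
    suff -> : f (sg_elt (Delta_GO (W_Delta Wy))) = 1%g by apply: group1.
    by apply/f_ker.
  - exists (sg_elt GO_r); [by []|exact: rK].
  - exists (sg_elt GO_s); [by []|exact: sK].
move=> /(klein_elt fr2 fs2 frs2) [i [j fx]].
have Sr : sg_set S r by apply: sub_gen; right; left.
have Ss : sg_set S s by apply: sub_gen; right; right.
pose y : sg_type GO := (sg_elt GO_r ^+ i * sg_elt GO_s ^+ j)%g.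
have vy : val y = (r ^+ i * s ^+ j)%g.
  by rewrite sg_valM !(morph_exp (val : {multiplicative sg_type GO -> P})).
have Wyx : sg_set W (val (y^-1 * x)%g).
  by apply/f_ker; rewrite gmulfM morph_inv /y gmulfM !morph_exp fx mulVg.
rewrite -(mulVKg y x) sg_valM vy; apply: sg_mul; first by apply: sg_mul; apply: sg_expg.
by apply: sub_gen; left.
Qed.

Let Delta_eq (T : set P) : T `<=` GO ->
  (forall x : sg_type GO, T (val x) <-> f x \in D) -> Delta = T :> set P.
Proof.
move=> TGO TD; apply/seteqP; split=> x.
  move=> Dx; have := Delta_mem (sg_elt (Delta_GO Dx)); move=> [/(_ Dx) h _].
  by have /TD := proj2 (DP _) h.
by move=> Tx; have /TD/DP/Delta_mem := Tx : T (val (sg_elt (TGO _ Tx))).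
Qed.

(** In the exceptional case [Delta] contains a conjugate of the pair r, s, and two characters of its
    four-group detect the generator. Otherwise [Delta] is cyclic modulo the preimage of [C], and the
    generator degenerates to 0. *)
Lemma weeks_overgroup_homology2 :
  (exceptional -> zmod_isog (group_homology G 2) 'Z_2) /\
  (~ exceptional -> forall x : group_homology G 2, x = 0).
Proof.
have [C nC cC] := dihedral12_normal3.
split.
  move=> exc.
  have [g GOg [Dr Ds]] : exists2 g, sg_set GO g &
      sg_set Delta (g * r * g^-1)%g /\ sg_set Delta (g * s * g^-1)%g.
    case: exc => [->|[g GOg ->]].
      by exists 1%g; [exact: sg_one|rewrite !gsimp].
    exists g => //; split; [exists r|exists s] => //.
      by apply: sub_gen; right; left.
    by apply: sub_gen; right; right.
  pose r' : G := sg_elt Dr; pose s' : G := sg_elt Ds.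
  pose h := (f (sg_elt GOg))^-1%g.
  have fr' : fG r' = (fr ^ h)%g.
    rewrite /h /conjg invgK mulgA -morph_inv -!gmulfM; congr (f _).
    by apply: val_inj; rewrite !sg_valM sg_valV.
  have fs' : fG s' = (fs ^ h)%g.
    rewrite /h /conjg invgK mulgA -morph_inv -!gmulfM; congr (f _).
    by apply: val_inj; rewrite !sg_valM sg_valV.
  have r2 : (fG r' ^+ 2 = 1)%g by rewrite fr' -conjXg fr2 conj1g.
  have s2 : (fG s' ^+ 2 = 1)%g by rewrite fs' -conjXg fs2 conj1g.
  have rs2 : ((fG r' * fG s') ^+ 2 = 1)%g.
    by rewrite fr' fs' -conjMg -conjXg frs2 conj1g.
  have sr2 : ((fG s' * fG r') ^+ 2 = 1)%g.
    by rewrite -(involutions_commute r2 s2 rs2) rs2.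
  have r1 : fG r' != 1%g by rewrite fr' conjg_eq1.
  have s1 : fG s' != 1%g by rewrite fs' conjg_eq1.
  have rs1 : fG r' != fG s' by rewrite fr' fs' (inj_eq (@conjg_inj _ h)).
  have sr1 : fG s' != fG r' by rewrite eq_sym.
  have [chi1 chi1M [chi1r chi1s]] := klein_char card_D12 nC cC r2 s2 rs2 r1 s1 rs1.
  have [chi2 chi2M [chi2s chi2r]] := klein_char card_D12 nC cC s2 r2 sr2 s1 r1 sr1.
  have vJ x : (g * x * g^-1 = x ^ g^-1)%g by rewrite /conjg invgK mulgA.
  have r'2 : (r' ^+ 2 = 1)%g.
    by apply: val_inj; rewrite expg2 sg_valM /= vJ -conjMg -expg2 r_sq conj1g.
  have rs' : commute r' s'.
    apply: val_inj; rewrite !sg_valM /= !vJ -!conjMg.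
    by rewrite (involutions_commute r_sq s_sq rs_sq).
  apply: (@homology2_Z2 G (chi1 \o fG) (chi2 \o fG) r' s') => //.
  - by move=> x y; rewrite /= -chi1M; congr chi1; exact: (@gmulfM _ _ fG).
  - by move=> x y; rewrite /= -chi2M; congr chi2; exact: (@gmulfM _ _ fG).
  - move=> x; apply: (bar_cycle_multiple presG fG_ker nC cC card_D12 rs').
    move=> x0.
    have [i [j ij]] := klein_complement card_D12 cC r2 s2 rs2 r1 s1 rs1 (fG x0).
    by exists i, j; rewrite gmulfM morph_inv gmulfM !morph_exp.
move=> nexc; apply: homology2_zero => x dx.
(* The first two cases of the trichotomy are exactly the exceptional ones. *)
have [t tG] : exists t : G, forall g : G, exists i : nat, (fG t ^- i * fG g)%g \in C.
  have [eqT|[q Dq]|[t' tD tg]] :=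
    klein_trichotomy card_D12 nC cC fr2 fs2 frs2 fr_neq1 fs_neq1 fr_neq_fs D.
  - case: nexc; left; apply: Delta_eq => // u; split=> [_|_]; last exact: sg_typeP.
    by rewrite -[_ \in _]/(f u \in (D : {set _})) eqT inE.
  - have [u fu] := f_surj q.
    (* The inverse appears because [:^] conjugates as q^-1 x q and [conj_set] as g x g^-1. *)
    case: nexc; right; exists ((val u)^-1)%g; first exact/sg_inv/sg_typeP.
    have conjE (v : sg_type GO) :
        conj_set (val u)^-1%g S (val v) <-> sg_set S (val (u * v * u^-1)%g).
      rewrite !sg_valM sg_valV; split=> [[y Sy <-]|Sx].
        by rewrite invgK !mulgA mulgV mul1g mulgK.
      exists (val u * val v * (val u)^-1)%g => //.
      by rewrite invgK !mulgA mulVg mul1g mulgVK.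
    apply: Delta_eq => [_ [y Sy <-]|v].
      rewrite invgK; do 2?[apply: sg_mul]; try exact: sg_typeP.
        exact/sg_inv/sg_typeP.
      apply: gen_min Sy => z [/W_Delta/Delta_GO //|[->|->]] //.
    rewrite conjE S_klein -[f v \in D]/(f v \in (D : {set _})) Dq mem_conjg.
    by rewrite !gmulfM morph_inv fu /conjg invgK mulgA.
  - move/DP: tD => [t ft]; exists t => g.
    by have [|i iC] := tg (fG g); [apply/DP; exists g|exists i; rewrite ft].
(* With s = 1 the generator is c(t, 1) - c(1, t), and both terms equal c(1, 1). *)
have [|g|n ->] :=
  bar_cycle_multiple presG fG_ker nC cC card_D12 (r := t) (s := 1%g) _ _ dx.
- exact: commute1.
- have [i iC] := tG g; exists i, 0%N.
  by rewrite mulg1 gmulfM morph_inv morph_exp.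
- rewrite (cocycle1r (univ_cocycleP (G := G))) (cocycle1l (univ_cocycleP (G := G))).
  by rewrite subrr mul0rz.
Qed.
End WeeksOvergroups.

(** * The lattices of PSL_2(C) between the Weeks group and [Gamma_O] *)

Theorem proposition3p2
  (R : realType)
  (* the cubic field k of discriminant -23, with its complex place *)
  (k : fieldExtType rat)
  (k_cubic : \dim {:k} = 3%N)
  (k_disc : has_discriminant k (- 23%:Z))
  (sigma : {rmorphism k -> R[i]})
  (sigma_complex : exists x, complex.Im (sigma x) != 0)
  (* the quaternion algebra B_W = (alpha, beta / k), ramified exactly at the
     real place and at the prime of norm 5 *)
  (alpha beta : k)
  (alpha_neq0 : alpha != 0)
  (beta_neq0 : beta != 0)
  (B_ramification : forall v : k -> R,
     absolute_value v -> nontrivial_abs v ->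
     (ramified_at alpha beta v <-> real_place v \/ finite_place_of_norm v 5))
  (* a maximal order, and B_W -> M_2(C) over the complex place *)
  (O : set (quaternion alpha beta))
  (O_maximal : is_maximal_order O)
  (rho : {rmorphism quaternion alpha beta -> 'M[R[i]]_2})
  (rho_sigma : forall c, rho (quat_scalar alpha beta c) = (sigma c)%:M)
  (Gamma_O : subgroup (PSL2 R[i]))
  (Gamma_O_def :
     Gamma_O = normalizer (norm_one_image O rho) :> set (PSL2 R[i]))
  (* the Weeks manifold group and its presentation *)
  (Gamma_W : subgroup (PSL2 R[i]))
  (a b : PSL2 R[i])
  (Gamma_W_weeks : weeks_group Gamma_W)
  (Gamma_W_presentation :
     is_presentation weeks_relations (fun i => if i then b else a) Gamma_W)
  (* its position in Gamma_O: the dihedral group of order 12 is 'D_12 *)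
  (Gamma_O_over_Gamma_W : quotient_isomorphic 'D_12 Gamma_O Gamma_W)
  (* the elements R and S *)
  (r s : PSL2 R[i])
  (Gamma_O_r : sg_set Gamma_O r)
  (Gamma_O_s : sg_set Gamma_O s)
  (r_a : (r * a * r^-1 = a^-1)%g)
  (r_b : (r * b * r^-1 = b^-1)%g)
  (s_a : (s * a * s^-1 = b)%g)
  (s_b : (s * b * s^-1 = a)%g)
  (r_sq : (r ^+ 2 = 1)%g)
  (s_sq : (s ^+ 2 = 1)%g)
  (rs_sq : ((r * s) ^+ 2 = 1)%g)
  (Delta : subgroup (PSL2 R[i]))
  (Delta_lattice : lattice Delta)
  (Gamma_W_Delta : Gamma_W `<=` Delta)
  (Delta_Gamma_O : Delta `<=` Gamma_O) :
  let exceptional :=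
    Delta = Gamma_O :> set (PSL2 R[i]) \/
    exists2 g, sg_set Gamma_O g &
      Delta = conj_set g (gen (Gamma_W `|` [set r; s])) :> set (PSL2 R[i]) in
  (exceptional -> zmod_isog (group_homology (sg_type Delta) 2) 'Z_2) /\
  (~ exceptional -> forall x : group_homology (sg_type Delta) 2, x = 0).
Proof.
case: Gamma_W_weeks => -[_ W_torsion_free _] _.
case: Gamma_O_over_Gamma_W => _ [f [f_surj f_ker]].
exact: (weeks_overgroup_homology2 Gamma_W_presentation W_torsion_free f_surj f_ker
  Gamma_O_r Gamma_O_s r_a r_b s_a r_sq s_sq rs_sq Gamma_W_Delta Delta_Gamma_O).
Qed.
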